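(* Let $(X,d,m)$ be a locally compact, connected, separable uniform local tree with a Radon measure $m$ of full support satisfying the uniform volume control (see context). Let $1\le p<\infty$ and $\lambda\ge4$. There exist $\varepsilon_0>0$ and $C>0$ such that for every $0<\varepsilon<\varepsilon_0$ there exist an at most countable cover of $X$ by balls $B_i^\varepsilon=B(x_i,\varepsilon)$ of radius $\varepsilon$ such that each point of $X$ belongs to at most $C$ of the balls $\lambda B_i^\varepsilon=B(x_i,\lambda\varepsilon)$, and a subordinated family of functions $\varphi_i^\varepsilon$ such that: (i) $\varphi_i^\varepsilon\in W^{1,p}(X,m)$; (ii) $0\le\varphi_i^\varepsilon\le1$ on $X$; (iii) $\sum_i\varphi_i^\varepsilon=1$ on $X$; (iv) $\varphi_i^\varepsilon=0$ in $X\setminus B(x_i,4\varepsilon)$; (v) $\int_{\mathcal S}|\partial\varphi_i^\varepsilon|^p\,d\nu\le\frac{C}{\varepsilon^{p-1}}$.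
   Context: Balls are $B(x,r)=\{y:d(x,y)<r\}$. A metric space $(T,d)$ is a (real) tree if (1) for all $u,v\in T$ there is a unique isometric embedding $\phi_{u,v}:[0,d(u,v)]\to T$ with $\phi_{u,v}(0)=u$, $\phi_{u,v}(d(u,v))=v$; (2) every injective continuous $\kappa:[0,1]\to T$ satisfies $\kappa([0,1])=\phi_{\kappa(0),\kappa(1)}([0,d(\kappa(0),\kappa(1))])$. A metric space $(X,d)$ is a local tree if for every $x\in X$ there is $\iota(x)>0$ such that $B(x,\iota(x))$ is a tree. Standing assumption: $(X,d)$ is a locally compact, connected, separable local tree. For $u,v\in B(x,\iota(x))$, $[u,v]=\phi_{u,v}([0,d(u,v)])$ and $]u,v[=\phi_{u,v}(]0,d(u,v)[)$, geodesics being taken in the tree $B(x,\iota(x))$. The skeleton is $\mathcal S=\bigcup_{x\in X}\bigcup_{y\in B(x,\iota(x))}]x,y[$. Let $\mathcal V$ be a countable dense subset of $\mathcal S$. The length measure $\nu$ is the unique measure on the $\sigma$-field generated by the sets $]x,y[$ ($x,y\in\mathcal V$, $d(x,y)<\iota(x)$) with $\nu(]x,y[)=d(x,y)$ for all $x,y\in\mathcal S$ with $d(x,y)<\iota(x)$. Weak gradient: $f\in C(X)$ is absolutely continuous in $B(x,\iota(x))$ if there is $g\in L^1_{loc}(\mathcal S\cap B(x,\iota(x)),\nu)$ (integrable on segments) with $f(u)-f(x)=\int_{]x,u[}g\,d\nu$ for every $u\in B(x,\iota(x))$; $g=:\partial_xf$ is unique $\nu$-a.e. $f\in AC(X)$ means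 $f$ is absolutely continuous in $B(x,\iota(x))$ for all $x\in X$; then $|\partial_xf|=|\partial_yf|$ $\nu$-a.e. on common domains, and one writes $|\partial f|$. $AC^p(X)$ is the set of $f\in AC(X)$ with $|\partial f|\in L^p(\mathcal S,\nu)$. $m$ is a Radon measure on $X$ with full support. $W^{1,p}(X,m)$ is the set of $f\in L^p(X,m)$ having an $m$-representative $\tilde f\in AC^p(X)$ (with which $f$ is identified), with $|\partial f|:=|\partial\tilde f|$. Uniform volume control: there are $r_0>0$, an increasing function $\Phi:[0,r_0]\to[0,+\infty)$, $\alpha\ge1$ and constants $c,C>0$ with $c\frac Rr\le\frac{\Phi(R)}{\Phi(r)}\le C(\frac Rr)^\alpha$ for $0<r\le R\le r_0$, and $c\,\Phi(r)\le m(B(x,r))\le C\,\Phi(r)$ for all $x\in X$, $0<r<r_0$. Uniform local tree: there is $0<\underline\iota\le\mathrm{diam}(X)$ such that $B(x,\underline\iota)$ is a tree for every $x\in X$. *)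

(* Defs.v *)
From HB Require Import structures.
From mathcomp Require Import all_boot all_order all_algebra.
From mathcomp Require Import all_classical all_reals all_analysis.

Set Implicit Arguments.
Unset Strict Implicit.
Unset Printing Implicit Defensive.

Import Order.TTheory GRing.Theory Num.Theory.
Import numFieldNormedType.Exports.

Local Open Scope classical_set_scope.
Local Open Scope ring_scope.

(* The library builds generated sigma-algebras on pointed types only, hence
   pointed (i.e. nonempty) metric spaces; the base point plays no role. *)
#[short(type="pmetricType")]
HB.structure Definition PMetric (K : numDomainType) :=
  { M of Metric K M & Pointed M }.

Section metric.
Context {R : realType} {X : pmetricType R}.
Implicit Types (A : set X) (u v x y : X) (phi kappa : R -> X).

Definition separable := exists2 D : set X, countable D & dense D.

Definition diam : \bar R :=
  ereal_sup [set (mdist x y)%:E | x in [set: X] & y in [set: X]].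

(* [phi] is only meaningful on [0, d(u, v)]; its values elsewhere are
   irrelevant. *)
Definition geodesic A u v phi :=
  [/\ phi 0 = u, phi (mdist u v) = v,
      forall t, t \in `[0, mdist u v] -> A (phi t) &
      forall s t, s \in `[0, mdist u v] -> t \in `[0, mdist u v] ->
        mdist (phi s) (phi t) = `|s - t|].

(* The subset A, with the induced metric, is a real tree. *)
Definition tree A :=
  [/\ forall u v, A u -> A v -> exists phi, geodesic A u v phi,
      forall u v phi psi, A u -> A v ->
        geodesic A u v phi -> geodesic A u v psi ->
        forall t, t \in `[0, mdist u v] -> phi t = psi t &
      forall kappa, {within `[0, 1], continuous kappa} ->
        {in `[0, 1] &, injective kappa} ->
        (forall t, t \in `[0, 1] -> A (kappa t)) ->
        forall phi, geodesic A (kappa 0) (kappa 1) phi ->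
        kappa @` `[0, 1] = phi @` `[0, mdist (kappa 0) (kappa 1)]].

(* The open segment ]u, v[ of the tree A: the union is over the (essentially
   unique) geodesic from u to v in A. *)
Definition oseg A u v : set X :=
  \bigcup_(phi in geodesic A u v) phi @` `]0, mdist u v[.

Definition local_tree (rad : X -> R) :=
  forall x, 0 < rad x /\ tree (ball x (rad x)).

(* The radii [rad x] are the ones used everywhere below to define segments,
   the length measure and absolute continuity; in a uniform local tree they
   are chosen no smaller than the uniform radius. Without such a bound the
   short segments need not generate enough measurable sets to determine the
   length measure. *)
Definition uniform_local_tree (rad : X -> R) :=
  local_tree rad /\
  exists rlow : R, [/\ 0 < rlow, (rlow%:E <= diam)%E,
    forall x, tree (ball x rlow) & forall x, rlow <= rad x].

Definition skeleton (rad : X -> R) : set X :=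
  \bigcup_x \bigcup_(y in ball x (rad x)) oseg (ball x (rad x)) x y.

Definition countable_dense_in (S V : set X) :=
  [/\ countable V, V `<=` S & S `<=` closure V].

Definition segments (rad : X -> R) (V : set X) : set (set X) :=
  [set s | exists x y, [/\ V x, V y, mdist x y < rad x &
                           s = oseg (ball x (rad x)) x y]].

End metric.

Arguments separable {R} X.
Arguments diam {R} X.

Notation borelType X := (g_sigma_algebraType (@open X)).

Notation segType rad V := (g_sigma_algebraType (segments rad V)).

Section measures.
Context {R : realType} {X : pmetricType R}.

Definition radon (m : {measure set (borelType X) -> \bar R}) :=
  [/\ forall K : set X, compact K -> (m K < +oo)%E,
      forall A : set (borelType X), measurable A ->
        m A = ereal_inf [set m U | U in [set U : set X | open U /\ A `<=` U]] &
      forall U : set X, open U ->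
        m U = ereal_sup [set m K | K in [set K : set X | compact K /\ K `<=` U]]].

Definition full_support (m : {measure set (borelType X) -> \bar R}) :=
  forall U : set X, open U -> U !=set0 -> (0 < m U)%E.

(* [Phi] is only meaningful on [0, r0]; "increasing" is read in the weak
   sense. The lower bound forces Phi r <> 0 for 0 < r <= r0. *)
Definition uniform_volume_control (m : {measure set (borelType X) -> \bar R}) :=
  exists (r0 : R) (Phi : R -> R) (alpha c C : R),
  [/\ [/\ 0 < r0, 1 <= alpha, 0 < c & 0 < C],
      (forall r, r \in `[0, r0] -> 0 <= Phi r) /\
      {in `[0, r0] &, {homo Phi : r s / r <= s}},
      forall r s, 0 < r -> r <= s -> s <= r0 ->
        c * (s / r) <= Phi s / Phi r <= C * (s / r) `^ alpha &
      forall (x : X) r, 0 < r -> r < r0 ->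
        ((c * Phi r)%:E <= m (ball x r) <= (C * Phi r)%:E)%E].

Context (rad : X -> R) (V : set X).
Context (nu : {measure set (segType rad V) -> \bar R}).

Local Notation S := (skeleton rad).
Local Notation B x := (ball x (rad x)).

(* The length measure lives on the skeleton; here it is carried by the whole
   space and vanishes off the skeleton. *)
Definition length_measure :=
  nu (~` S) = 0%E /\
  forall x y : X, S x -> S y -> mdist x y < rad x ->
    measurable (oseg (B x) x y : set (segType rad V)) /\
    nu (oseg (B x) x y) = (mdist x y)%:E.

Definition weak_gradient (x : X) (f : X -> R) (g : segType rad V -> R) :=
  [/\ measurable_fun (S `&` B x : set (segType rad V)) g,
      forall u v : X, B x u -> B x v ->
        nu.-integrable (oseg (B x) u v) (EFin \o g) &
      forall u : X, B x u ->
        (f u - f x)%:E = (\int[nu]_(z in oseg (B x) x u) (g z)%:E)%E].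

Definition abs_continuous (f : X -> R) :=
  continuous f /\ forall x, exists g, weak_gradient x f g.

(* [h] is a version of |df|: it is only determined nu-almost everywhere on
   the skeleton. *)
Definition abs_gradient (f : X -> R) (h : segType rad V -> R) :=
  measurable_fun (S : set (segType rad V)) h /\
  forall x, exists2 g, weak_gradient x f g &
    {ae nu, forall z, (S `&` B x) z -> h z = `|g z|}.

Definition energy (p : R) (h : segType rad V -> R) : \bar R :=
  (\int[nu]_(z in S) (`|h z| `^ p)%:E)%E.

Definition abs_continuous_Lp (p : R) (f : X -> R) :=
  abs_continuous f /\ exists2 h, abs_gradient f h & (energy p h < +oo)%E.

Definition sobolev (m : {measure set (borelType X) -> \bar R}) (p : R)
    (f : borelType X -> R) :=
  f \in Lfun m p%:E /\
  exists2 ft : X -> R, abs_continuous_Lp p ft & {ae m, forall z, f z = ft z}.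

End measures.

(* Main.v *)
Require Import Defs.
From HB Require Import structures.
From mathcomp Require Import all_boot all_order all_algebra finmap.
From mathcomp Require Import all_classical all_reals all_analysis.
From mathcomp Require Import measurable_realfun.
From mathcomp Require Import ring lra.

Set Implicit Arguments.
Unset Strict Implicit.
Unset Printing Implicit Defensive.

Import Order.TTheory GRing.Theory Num.Theory.
Import numFieldNormedType.Exports.

Local Open Scope classical_set_scope.
Local Open Scope ring_scope.

(** A cut-off function of the distance to a centre is useless here: its gradient
    has modulus [1 / eps] on the whole skeleton of an annulus, and the skeleton
    of a ball may have infinite length. The partition is built from functions
    that only see a finite subtree.

    Fix an [eps / 2]-separated net whose [eps]-balls cover [X]. Volume control
    bounds, uniformly in [eps], the number [N] of net points in a ball of radius
    a fixed multiple of [eps] ([volume_packing]). Let [x_i] be a net point and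
    consider the subtree spanned by [x_i] and the net points within [5 eps]. It
    has length at most [5 N eps], and projecting a point of [B(x_i, 4 eps)] on it
    moves the point by less than [eps]. A tent around [x_i] is a cut-off function
    of the distance from [x_i] to this projection. That distance is the maximum
    over the neighbours [x_k] of the Gromov products of [y] and [x_k] based at
    [x_i], so the tents are given by a formula in the distance alone: that they
    are [1 / eps]-Lipschitz, equal to 1 on [B(x_i, eps)] and supported in
    [B(x_i, 3 eps)] are triangle inequalities. The tree structure enters through
    one fact: a Gromov product is locally constant off the segment between [x_i]
    and [x_k] ([gromov_locally_constant]).

    The functions of the partition are the increments of the running maximum of
    the tents. Their sum telescopes to 1; they lie below the corresponding
    tents; they are [2 / eps]-Lipschitz however many tents there are; and the
    [i]-th one is locally constant off the subtrees of the at most [N] tents that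
    meet the [i]-th ball ([piece_locally_constant]). The energy is therefore at
    most [(2 / eps) ^ p] times the length [5 N ^ 2 eps] of these subtrees.

    It remains to relate weak gradients to derivatives. Along a geodesic, the
    length measure is the image of the Lebesgue measure ([nu_arc_image]). By
    Lebesgue differentiation a weak gradient is thus almost everywhere a
    derivative along the geodesics issued from the centre of its chart
    ([weak_gradient_slope]); it is bounded by the Lipschitz constant and vanishes
    where the function is locally constant ([energy_bound]). Conversely a
    Lipschitz function of a real variable is a primitive ([lipschitz_primitive]),
    and countably many geodesics cover the skeleton of a chart
    ([skeleton_ballE]); hence Lipschitz functions on [X] are absolutely
    continuous ([lipschitz_weak_gradient]). *)

(** * Lipschitz functions of a real variable *)
Section lipschitz_stieltjes.
Context {R : realType} (F : R -> R) (K : R).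
Context (FK : forall s t, `|F s - F t| <= K * `|s - t|).

Definition tilt (t : R) : R := K * t + F t.

Lemma tilt_nondecreasing : {homo tilt : s t / s <= t}.
Proof.
move=> s t st; have := FK s t; rewrite ler_norml (distrC s).
by rewrite ger0_norm ?subr_ge0// /tilt => /andP[_]; lra.
Qed.

Lemma lipschitz_continuous : continuous F.
Proof.
move=> t; apply/(@cvgrPdist_le _ R^o) => /= e e0.
have K0 : 0 < `|K| + 1 by rewrite ltr_wpDl.
exists ((`|K| + 1)^-1 * e) => /=; first by rewrite mulr_gt0// invr_gt0.
move=> s /= ts; apply: (le_trans (FK t s)).
apply: (@le_trans _ _ ((`|K| + 1) * `|t - s|)).
  by rewrite ler_wpM2r// ler_wpDr// ler_norm.
by rewrite -ler_pdivlMl// ltW.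
Qed.

Lemma tilt_right_continuous : right_continuous tilt.
Proof.
apply/right_continuousW => t; apply: (@cvgD _ R^o); last exact: lipschitz_continuous.
by apply: (@cvgM _ R); [exact: cvg_cst|exact: cvg_id].
Qed.

Definition tilt_cumulative : cumulative R R :=
  HB.pack tilt (isCumulative.Build R _ R tilt
    tilt_nondecreasing tilt_right_continuous).

End lipschitz_stieltjes.

Section lipschitz_primitive.
Context {R : realType}.
Implicit Types (F : R -> R) (K : R).
Local Notation leb := (@lebesgue_measure R).

Lemma lebesgue_stieltjes_itv (G : cumulative R R) (a b : R) : a <= b ->
  lebesgue_stieltjes_measure G `]a, b]%classic = (G b - G a)%:E.
Proof.
move=> ab; rewrite /lebesgue_stieltjes_measure/= /measure_extension/=.
by rewrite measurable_mu_extE/= ?wlength_itv_bnd//; exact: is_ocitv.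
Qed.

Lemma lipschitzN F K : (forall s t, `|F s - F t| <= K * `|s - t|) ->
  forall s t, `|- F s - - F t| <= K * `|s - t|.
Proof. by move=> FK s t; rewrite -opprD normrN. Qed.

Lemma lipschitz_const_ge0 F K : (forall s t, `|F s - F t| <= K * `|s - t|) -> 0 <= K.
Proof.
by move=> FK; have := le_trans (normr_ge0 _) (FK 0 1); rewrite sub0r normrN1 mulr1.
Qed.

(** The Stieltjes measures of [K t + F t] and of [K t - F t] add up to [2 K]
    times the Lebesgue measure. *)
Lemma lebesgue_stieltjes_tilt_le F K
    (FK : forall s t, `|F s - F t| <= K * `|s - t|) (A : set (measurableTypeR R)) :
  measurable A ->
  (lebesgue_stieltjes_measure (tilt_cumulative FK) A <= (2 * K)%:E * leb A)%E.
Proof.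
move=> mA; have K0 := lipschitz_const_ge0 FK.
have K20 : 0 <= 2 * K by rewrite mulr_ge0.
pose m1 := lebesgue_stieltjes_measure (tilt_cumulative FK).
pose m2 := lebesgue_stieltjes_measure (tilt_cumulative (lipschitzN FK)).
have cE (X : set R) : ocitv X ->
  (measure_add m1 m2 X = mscale (NngNum K20) leb X)%E.
  move=> [[a b] _ <-]/=; rewrite measure_addE/= /mscale/= /m1 /m2.
  have [ab|/ltW ba] := leP a b.
    rewrite !lebesgue_stieltjes_itv// /tilt/= lebesgue_measure_itv/= lte_fin.
    case: ltP => [_|ba]; first by rewrite -!EFinD -EFinM; congr EFin; rewrite /tilt; ring.
    have -> : a = b by apply/eqP; rewrite eq_le ab.
    by rewrite mule0 !subrr -EFinD addr0.
  by rewrite set_itv_ge ?bnd_simp -?leNgt// !measure0 mule0 adde0.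
suff -> : ((2 * K)%:E * leb A = measure_add m1 m2 A)%E.
  by rewrite measure_addE leeDl.
pose g (n : nat) : set (measurableTypeR R) := `]- n%:R, n%:R]%classic.
apply/esym; apply: (@measure_unique _ R (measurableTypeR R) (@ocitv R) g _ _ _ _
  (measure_add m1 m2) (mscale (NngNum K20) leb)) => //.
- exact: ocitvI.
- by move=> n; exact: is_ocitv.
- rewrite -subTset => x _; exists (Num.bound `|x|) => //=.
  have := archi_boundP (normr_ge0 x); rewrite ltr_norml => /andP[h1 h2].
  by rewrite /g /= in_itv/= h1 ltW.
- move=> n; rewrite [ltLHS](cE _ (is_ocitv (- n%:R) n%:R)).
  rewrite /mscale/= lebesgue_measure_itv/=.
  by case: ifP => _; rewrite ?mule0 // -EFinD -EFinM ltry.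
Qed.

(** A Lipschitz function is the primitive of a density: the Stieltjes measure of
    its nondecreasing tilt [K t + F t] is dominated by [2 K] times the Lebesgue
    measure, so that Radon-Nikodym applies. *)
Lemma lipschitz_primitive F K (L : R) :
  (forall s t, `|F s - F t| <= K * `|s - t|) ->
  exists2 G : R -> R, leb.-integrable `]0, L[ (EFin \o G) &
    forall t, 0 <= t -> t <= L ->
      (F t - F 0)%:E = (\int[leb]_(s in `]0%R, t[) (G s)%:E)%E.
Proof.
move=> FK.
pose H := tilt_cumulative FK.
have mL : measurable (`]0, L] : set (measurableTypeR R)) by exact: measurable_itv.
have HL : (lebesgue_stieltjes_measure H `]0%R, L]%classic < +oo)%E.
  have [L0|/ltW L0] := leP 0 L; first by rewrite lebesgue_stieltjes_itv// ltry.
  by rewrite set_itv_ge ?bnd_simp -?leNgt// measure0 ltry.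
have dom : mfrestr mL HL `<< leb.
  apply/null_content_dominatesP => A mA A0; rewrite /mfrestr/= /mrestr/=.
  apply/eqP; rewrite eq_le measure_ge0 andbT.
  apply: (@le_trans _ _ (lebesgue_stieltjes_measure H A)).
    by apply: le_measure => //; rewrite inE//; exact: measurableI.
  by apply: le_trans (lebesgue_stieltjes_tilt_le FK mA) _; rewrite A0 mule0.
have [g [gfin gint gE]] : exists g : R -> \bar R,
    [/\ forall x, g x \is a fin_num, leb.-integrable setT g &
      forall t, 0 <= t -> t <= L ->
        (\int[leb]_(s in `]0%R, t]) g s = (H t - H 0)%:E)%E].
  have [g [_ gfin gint gE]] := radon_nikodym_sigma_finite dom.
  exists g; split => // t t0 tL.
  have <- := gE `]0, t]%classic (measurable_itv _).
  transitivity (lebesgue_stieltjes_measure H (`]0, t]%classic `&` `]0, L]%classic)) => //.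
  rewrite setIidl; last first.
    by move=> x/=; rewrite !in_itv/= => /andP[-> /le_trans ->].
  by rewrite lebesgue_stieltjes_itv.
have gEF : EFin \o (fine \o g) = g by apply/funext => x /=; rewrite fineK.
exists (fun t => fine (g t) - K).
  have -> : EFin \o (fun t => fine (g t) - K) = (g \- cst K%:E)%E.
    by apply/funext => x /=; rewrite EFinB fineK.
  apply: integrableB => //; first by apply: integrableS gint.
  apply/integrableP; split; first exact: measurable_cst.
  rewrite integral_cst//=; apply: lte_mul_pinfty => //.
  by rewrite lebesgue_measure_itv/=; case: ifP => _; rewrite ?ltry.
move=> t t0 tL.
have -> : (\int[leb]_(s in `]0%R, t[) (fine (g s) - K)%:E =
    \int[leb]_(s in `]0%R, t[) (g s) - \int[leb]_(s in `]0%R, t[) cst K%:E s)%E.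
  rewrite -integralB//.
  - by apply: eq_integral => x _; rewrite EFinB fineK.
  - by apply: integrableS gint.
  - apply/integrableP; split; first exact: measurable_cst.
    rewrite integral_cst//=; apply: lte_mul_pinfty => //.
    by rewrite lebesgue_measure_itv/=; case: ifP => _; rewrite ?ltry.
rewrite integral_cst//= lebesgue_measure_itv/= lte_fin.
have -> : (\int[leb]_(s in `]0%R, t[) g s = (H t - H 0)%:E)%E.
  rewrite integral_itv_bndo_bndc ?gE//.
  by apply: (@measurable_funS _ _ _ _ setT) => //; exact: measurable_int gint.
rewrite /H /= /tilt mulr0 add0r.
case: ltP => [_|t0']; first by rewrite oppr0 adde0 -EFinM -EFinB; congr EFin; ring.
have -> : t = 0 by apply/eqP; rewrite eq_le t0 t0'.
by rewrite mule0 sube0 mulr0 add0r.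
Qed.

(** The derivative in epsilon-delta form: it is only used through comparisons of
    increments. *)
Definition has_slope F (t l : R) := forall e, 0 < e ->
  exists2 d, 0 < d & forall s, `|s - t| < d ->
    `|F s - F t - l * (s - t)| <= e * `|s - t|.

Lemma derivable_has_slope F (t : R) : derivable F t 1 -> has_slope F t (derive1 F t).
Proof.
move=> /[dup] dF /cvg_ex[l]; rewrite /= => Fl.
have -> : derive1 F t = l.
  by rewrite derive1E; apply/cvg_lim; [exact: Rhausdorff|exact: Fl].
move=> e e0; move/(@cvgrPdist_le _ R^o) : Fl => /(_ e e0)[d /= d0 dF'].
exists d => // s std; have [->|/negbTE ts] := eqVneq s t.
  by rewrite !subrr mulr0 subrr normr0 mulr0.
have st0 : s - t != 0 by rewrite subr_eq0 ts.
have := dF' (s - t); rewrite /= sub0r normrN => /(_ std st0).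
rewrite /GRing.scale/= mulr1 subrK => h.
rewrite -ler_pdivrMr ?normr_gt0// -normf_div; apply: le_trans h.
rewrite distrC le_eqVlt; apply/orP; left; apply/eqP; congr (`| _ |).
by field.
Qed.

(** Lebesgue differentiation, applied to the density extended by 0 outside the
    interval. *)
Lemma primitive_has_slope F (G : R -> R) (L : R) :
  leb.-integrable `]0, L[ (EFin \o G) ->
  (forall t, 0 <= t -> t <= L ->
    (F t - F 0)%:E = (\int[leb]_(s in `]0%R, t[) (G s)%:E)%E) ->
  {ae leb, forall t, t \in `]0, L[ -> has_slope F t (G t)}.
Proof.
move=> intG FE.
have := lebesgue_differentiation (integrable_locally (measurable_itv `]0, L[) intG).
apply: filterS; first exact: (ae_filter_ringOfSetsType leb).
move=> t Gt tL; move: (tL); rewrite in_itv/= => /andP[t0 tL'].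
pose G' := G \_ `]0, L[.
have intG' : leb.-integrable `]0, L] (EFin \o G').
  apply: (@integrableS _ _ _ _ setT) => //.
  rewrite /G' -restrict_EFin.
  exact: (@integrable_mkcond _ _ _ leb _ _ (measurable_itv `]0, L[)).1 intG.
have [/derivable_has_slope + F'E] :=
  @FTC1_lebesgue_pt _ G' (BRight 0) t L tL' intG' t0 Gt.
rewrite {}F'E /G' patchE mem_set// => slope e /slope [d d0 dF].
pose d' := Num.min d (Num.min t (L - t)).
exists d'; first by rewrite !lt_min d0 t0 subr_gt0.
move=> s; rewrite !lt_min => /andP[sd /andP[st sL]].
have s0 : 0 < s by move: st; rewrite ltr_norml => /andP[]; lra.
have {}sL : s < L by move: sL; rewrite ltr_norml => /andP[]; lra.
have {}FE u : 0 < u -> u < L -> \int[leb]_(x in `]0, u]) G' x = F u - F 0.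
  move=> u0 uL; have := FE u (ltW u0) (ltW uL).
  rewrite integral_itv_bndo_bndc; last first.
    apply: (@measurable_funS _ _ _ _ `]0, L[%classic) => //.
      by apply: subset_itvl; rewrite bnd_simp ltW.
    exact: measurable_int intG.
  move=> /(congr1 fine)/= ->; rewrite /Rintegral; congr fine.
  apply: eq_integral => x; rewrite inE/= in_itv/= => /andP[x0 xu].
  by rewrite /G' patchE mem_set//= in_itv/= x0 (le_lt_trans xu).
have := dF s sd; rewrite !FE//.
by have -> : F s - F 0 - (F t - F 0) = F s - F t by ring.
Qed.

Lemma has_slope_bound F K (t l : R) :
  (forall s t, `|F s - F t| <= K * `|s - t|) -> has_slope F t l -> `|l| <= K.
Proof.
move=> FK Fl; apply/ler_addgt0Pr => e e0; have [d d0 dF] := Fl e e0.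
have d20 : 0 < d / 2 by rewrite divr_gt0.
have tE : t + d / 2 - t = d / 2 by rewrite addrAC subrr add0r.
have : `|F (t + d / 2) - F t - l * (d / 2)| <= e * (d / 2).
  have := dF (t + d / 2); rewrite tE gtr0_norm//; apply.
  by rewrite ltr_pdivrMr// ltr_pMr// ltr1n.
have := FK (t + d / 2) t; rewrite tE (gtr0_norm d20) => h1 h2.
rewrite -(ler_pM2r d20) mulrDl -{1}(gtr0_norm d20) -normrM.
have -> : l * (d / 2) = (F (t + d / 2) - F t) - (F (t + d / 2) - F t - l * (d / 2)).
  by ring.
by rewrite (le_trans (ler_normB _ _))// lerD.
Qed.

Lemma has_slope_locally_constant F (t l : R) : has_slope F t l ->
  (exists2 d, 0 < d & forall s, `|s - t| < d -> F s = F t) -> l = 0.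
Proof.
move=> Fl [d d0 dF]; apply/eqP; rewrite -normr_eq0 eq_le normr_ge0 andbT.
apply/ler_addgt0Pr => e e0; rewrite add0r; have [d' d'0 dF'] := Fl e e0.
(* any admissible increment strictly inside both neighbourhoods will do *)
pose r := Num.min d d' / 2.
have m0 : 0 < Num.min d d' by rewrite lt_min d0.
have r0 : 0 < r by rewrite divr_gt0.
have rm : r < Num.min d d' by rewrite ltr_pdivrMr// ltr_pMr// ltr1n.
have tE : `|t + r - t| = r by rewrite addrAC subrr add0r gtr0_norm.
move: rm; rewrite lt_min => /andP[rd rd'].
have := dF' (t + r); rewrite tE => /(_ rd').
rewrite (dF (t + r)) ?tE// subrr sub0r normrN normrM tE.
by rewrite ler_pM2r.
Qed.

(** This compares derivatives along two geodesics that share a sequence of points: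
    they may run through it in opposite directions, hence the moduli. *)
Lemma has_slope_norm_eq F1 F2 (t1 t2 l1 l2 : R) :
  has_slope F1 t1 l1 -> has_slope F2 t2 l2 ->
  (forall d, 0 < d -> exists s1 s2, [/\ 0 < `|s1 - t1|, `|s1 - t1| < d,
    `|s2 - t2| = `|s1 - t1| & F1 s1 - F1 t1 = F2 s2 - F2 t2]) ->
  `|l1| = `|l2|.
Proof.
move=> F1l F2l H.
suff D e : 0 < e -> `| `|l1| - `|l2| | <= e + e.
  apply/eqP; rewrite -subr_eq0 -normr_eq0 eq_le normr_ge0 andbT.
  apply/ler_addgt0Pr => e e0; rewrite add0r [leRHS]splitr D// divr_gt0//.
move=> e0; have [d1 d10 D1] := F1l e e0; have [d2 d20 D2] := F2l e e0.
have /H : 0 < Num.min d1 d2 by rewrite lt_min d10.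
move=> [s1 [s2 [st0]]]; rewrite lt_min => /andP[sd1 sd2] sE FE.
have := D1 s1 sd1; rewrite FE => h1.
have := D2 s2; rewrite sE => /(_ sd2) h2.
rewrite -(ler_pM2r st0).
have -> : `| `|l1| - `|l2| | * `|s1 - t1| =
    `| `|l1 * (s1 - t1)| - `|l2 * (s2 - t2)| |.
  by rewrite !normrM sE -mulrBl normrM normr_id.
rewrite mulrDl (le_trans (ler_dist_dist _ _))//.
have -> : l1 * (s1 - t1) - l2 * (s2 - t2) =
  (F2 s2 - F2 t2 - l2 * (s2 - t2)) - (F2 s2 - F2 t2 - l1 * (s1 - t1)) by ring.
by rewrite (le_trans (ler_normB _ _))// lerD.
Qed.

Lemma has_slope_left_cvg F (t l : R) : has_slope F t l ->
  (n.+1%:R * (F t - F (t - n.+1%:R^-1))) @[n --> \oo] --> l.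
Proof.
move=> Fl; apply/(@cvgrPdist_le _ R^o) => e e0; have [d d0 dF] := Fl e e0.
near=> n.
have n0 : 0 < n.+1%:R^-1 :> R by rewrite invr_gt0.
have nd : n.+1%:R^-1 < d :> R.
  near: n; exists (Num.bound d^-1) => // n/= dn.
  rewrite -[ltRHS]invrK ltf_pV2 ?posrE ?invr_gt0//.
  rewrite (lt_le_trans (archi_boundP _)) ?ler_nat ?invr_ge0 ?(ltW d0)//.
  exact: leq_trans dn (leqnSn n).
have := dF (t - n.+1%:R^-1).
have -> : t - n.+1%:R^-1 - t = - n.+1%:R^-1 by ring.
rewrite normrN gtr0_norm// => /(_ nd) h.
rewrite -(ler_pM2r n0) -[X in _ * X <= _](gtr0_norm n0) -normrM; apply: le_trans h.
rewrite distrC le_eqVlt; apply/orP; left; apply/eqP.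
by rewrite -normrN; congr (`| _ |); field.
Unshelve. all: by end_near. Qed.

End lipschitz_primitive.

(** * Geodesics as isometric maps of an interval *)
Section arcs.
Context {R : realType} {X : pmetricType R}.
Implicit Types (phi c : R -> X) (L a b s t : R) (A : set X) (x y z u v : X).

Definition unit_arc phi L := forall s t, 0 <= s <= L -> 0 <= t <= L ->
  mdist (phi s) (phi t) = `|s - t|.

(** Precomposing a geodesic of length [L] with [clamp L] extends it to a
    continuous map of the whole line. *)
Definition clamp L t : R := Num.max 0 (Num.min t L).

Lemma clamp_itv L t : 0 <= L -> 0 <= clamp L t <= L.
Proof.
move=> L0; rewrite /clamp le_max lexx/= ge_max L0/=.
by rewrite ge_min lexx orbT.
Qed.

Lemma clamp_id L t : 0 <= t <= L -> clamp L t = t.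
Proof. by move=> /andP[t0 tL]; rewrite /clamp min_l// max_r. Qed.

Lemma clamp_nonexpansive L s t : `|clamp L s - clamp L t| <= `|s - t|.
Proof.
have h1 := ler_norm (s - t); have h2 := ler_norm (t - s).
rewrite distrC in h2; have h3 := normr_ge0 (s - t).
rewrite /clamp ler_norml.
by case: (leP s L) => ?; case: (leP t L) => ?; case: (leP 0 s) => ?;
  case: (leP 0 t) => ?; case: (leP 0 L) => ?;
  apply/andP; split; lra.
Qed.

Lemma arcS phi L a b : unit_arc phi L -> 0 <= a -> a <= b -> b <= L ->
  unit_arc (fun t => phi (a + t)) (b - a).
Proof.
move=> phiL a0 ab bL s t /andP[s0 sL] /andP[t0 tL].
rewrite phiL; last 2 first.
- by apply/andP; split; lra.
- by apply/andP; split; lra.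
by congr (`| _ |); ring.
Qed.

Lemma arc_inj phi L s t : unit_arc phi L -> 0 <= s <= L -> 0 <= t <= L ->
  phi s = phi t -> s = t.
Proof.
move=> phiL sL tL st; apply/eqP; rewrite -subr_eq0 -normr_eq0 -phiL// st.
by rewrite mdistxx.
Qed.

Lemma lipschitz_curve_continuous K (f : R -> X) :
  (forall s t, mdist (f s) (f t) <= K * `|s - t|) -> continuous f.
Proof.
move=> fK t; apply/metricType_numDomainType.cvgrPdist_lt => e e0.
have K0 : 0 < `|K| + 1 by rewrite ltr_wpDl.
exists ((`|K| + 1)^-1 * e) => /=; first by rewrite mulr_gt0// invr_gt0.
move=> s /= ts; apply: (le_lt_trans (fK t s)).
apply: (@le_lt_trans _ _ ((`|K| + 1) * `|t - s|)).
  by rewrite ler_wpM2r// ler_wpDr// ler_norm.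
by rewrite -ltr_pdivlMl.
Qed.

Lemma arc_clamp_nonexpansive phi L s t : unit_arc phi L -> 0 <= L ->
  mdist (phi (clamp L s)) (phi (clamp L t)) <= `|s - t|.
Proof. by move=> phiL L0; rewrite phiL ?clamp_itv//; exact: clamp_nonexpansive. Qed.

Lemma arc_clamp_continuous phi L : unit_arc phi L -> 0 <= L ->
  continuous (phi \o clamp L).
Proof.
move=> phiL L0; apply: (@lipschitz_curve_continuous 1) => s t.
by rewrite mul1r; exact: arc_clamp_nonexpansive.
Qed.

Lemma closed_arc phi L a b : unit_arc phi L -> 0 <= a -> b <= L ->
  closed (phi @` `[a, b]).
Proof.
move=> phiL a0 bL; have [ab|ab] := leP a b; last first.
  by rewrite set_itv_ge ?bnd_simp -?ltNge// image_set0; exact: closed0.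
have L0 : 0 <= L by rewrite (le_trans a0)// (le_trans ab).
apply: compact_closed; first exact: metric_hausdorff.
have -> : phi @` `[a, b] = (phi \o clamp L) @` `[a, b].
  apply/seteqP; split=> _ [t /= tab <-]; exists t => //=; rewrite clamp_id//;
  by move: tab; rewrite in_itv/= => /andP[? ?]; apply/andP; split; lra.
apply: continuous_compact; last exact: segment_compact.
by apply: continuous_subspaceT; exact: arc_clamp_continuous.
Qed.

Lemma geodesic_arc A u v phi : geodesic A u v phi -> unit_arc phi (mdist u v).
Proof. by case=> _ _ _ H s t sL tL; apply: H; rewrite in_itv. Qed.

Lemma oseg_tree A u v phi : tree A -> A u -> A v -> geodesic A u v phi ->
  oseg A u v = phi @` `]0, mdist u v[.
Proof.
move=> [_ uniq _] Au Av guv; apply/seteqP; split=> z; last by exists phi.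
move=> [psi gpsi [t tL <-]]; exists t => //; apply: (uniq u v) => //.
by move: t tL => t /=; rewrite !in_itv/= => /andP[/ltW -> /ltW ->].
Qed.

Lemma geodesic_sub A phi L a b : unit_arc phi L -> 0 <= a -> a <= b -> b <= L ->
  (forall t, a <= t <= b -> A (phi t)) ->
  geodesic A (phi a) (phi b) (fun t => phi (a + t)).
Proof.
move=> phiL a0 ab bL Aphi.
have dE : mdist (phi a) (phi b) = b - a.
  rewrite phiL; [|apply/andP; split; lra..].
  by rewrite distrC ger0_norm// subr_ge0.
split; rewrite ?addr0 ?dE//.
- by rewrite addrC subrK.
- by move=> t; rewrite in_itv/= => /andP[? ?]; apply: Aphi; apply/andP; split; lra.
- by move=> s t; rewrite !in_itv/=; exact: (arcS phiL a0 ab bL).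
Qed.

Lemma arc_image_sub phi a b : (fun t => phi (a + t)) @` `]0, b - a[ = phi @` `]a, b[.
Proof.
apply/seteqP; split=> _ [t /= + <-]; rewrite in_itv/= => /andP[t1 t2].
  by exists (a + t) => //=; rewrite in_itv/=; apply/andP; split; lra.
by exists (t - a); rewrite ?in_itv/= ?subrKC//; apply/andP; split; lra.
Qed.

Lemma ball_mdist x (r : R) y : ball x r y <-> mdist x y < r.
Proof. by rewrite ballEmdist. Qed.

End arcs.

(** * Metric geometry of a tree *)
Section tree_geometry.
Context {R : realType} {X : pmetricType R} (A : set X) (treeA : tree A).
Implicit Types (u v w x y z b p : X) (s t a c : R).
Local Notation d := mdist.

Definition between x z w := d x w + d w z = d x z.

(** Both geodesics are clamped so that the glued path is nonexpansive on the whole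
    line. *)
Definition glue (phi psi : R -> X) (a c : R) (t : R) : X :=
  if t <= a then phi (clamp a t) else psi (clamp c (t - a)).

Lemma glue_left phi psi a c t : 0 <= t <= a -> glue phi psi a c t = phi t.
Proof. by move=> /[dup] h /andP[_ ta]; rewrite /glue ta clamp_id. Qed.

Lemma glue_right phi psi a c t : phi a = psi 0 -> 0 <= a -> a <= t <= a + c ->
  glue phi psi a c t = psi (t - a).
Proof.
move=> ab a0 /andP[ta tc]; rewrite /glue.
case: ltP => [at_|ta'].
  by rewrite clamp_id//; apply/andP; split; lra.
have -> : t = a by apply/eqP; rewrite eq_le ta ta'.
by rewrite clamp_id ?a0 ?lexx// subrr.
Qed.

Lemma glue_nonexpansive phi psi a c s t : unit_arc phi a -> unit_arc psi c ->
  0 <= a -> 0 <= c -> phi a = psi 0 ->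
  d (glue phi psi a c s) (glue phi psi a c t) <= `|s - t|.
Proof.
move=> phia psic a0 c0 ab.
wlog st : s t / s <= t => [H|].
  have [/H//|/ltW/H] := leP s t.
  by rewrite metric_sym distrC.
rewrite [leRHS]distrC ger0_norm ?subr_ge0//.
have dphi (u v : R) : d (phi (clamp a u)) (phi (clamp a v)) <= `|u - v|.
  exact: arc_clamp_nonexpansive.
have dpsi (u v : R) : d (psi (clamp c u)) (psi (clamp c v)) <= `|u - v|.
  exact: arc_clamp_nonexpansive.
rewrite /glue; case: (leP s a) => sa; case: (leP t a) => ta.
- by rewrite (le_trans (dphi _ _))// distrC ger0_norm ?subr_ge0.
- apply: le_trans (metric_triangle _ (phi (clamp a a)) _) _.
  have h1 := dphi s a; have h2 := dpsi 0 (t - a).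
  rewrite distrC ger0_norm ?subr_ge0// in h1.
  rewrite sub0r normrN ger0_norm ?subr_ge0 ?(ltW ta)// in h2.
  rewrite (clamp_id (t := a)) ?a0 ?lexx// in h1 *.
  rewrite (clamp_id (t := 0)) ?c0 ?lexx// -ab in h2.
  lra.
- by lra.
- rewrite (le_trans (dpsi _ _))// distrC ger0_norm; lra.
Qed.

Lemma geodesic_exists x z : A x -> A z -> exists phi, geodesic A x z phi.
Proof. by case: treeA => + _ _; exact. Qed.

Lemma geodesic_between x z phi t : geodesic A x z phi -> 0 <= t <= d x z ->
  [/\ A (phi t), between x z (phi t), d x (phi t) = t & d (phi t) z = d x z - t].
Proof.
move=> g /[dup] tL /andP[t0 tL']; have [p0 p1 pA pd] := g.
have h1 : d x (phi t) = t.
  by rewrite -{1}p0 pd ?in_itv/= ?lexx ?mdist_ge0// sub0r normrN ger0_norm.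
have h2 : d (phi t) z = d x z - t.
  rewrite -[in LHS]p1 pd ?in_itv/= ?lexx ?mdist_ge0//.
  by rewrite distrC ger0_norm ?subr_ge0.
by split => //; [apply: pA; rewrite in_itv|rewrite /between h1 h2; lra].
Qed.

(** Injective paths of a tree are geodesics, hence a point where two geodesics
    meet without overlapping lies between their other ends. *)
Lemma between_concat u v b : A u -> A v -> A b ->
  (forall p, A p -> between u b p -> between b v p -> p = b) -> between u v b.
Proof.
move=> Au Av Ab only_b.
have [->|/eqP ub] := eqVneq u b; first by rewrite /between mdistxx add0r.
have [<-|/eqP bv] := eqVneq b v; first by rewrite /between mdistxx addr0.
have [phi gphi] := geodesic_exists Au Ab; have [psi gpsi] := geodesic_exists Ab Av.
pose a := d u b; pose c := d b v.
have a0 : 0 < a by rewrite mdist_gt0; apply/eqP.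
have c0 : 0 < c by rewrite mdist_gt0; apply/eqP.
have [p0 p1 pA pd] := gphi; have [q0 q1 qA qd] := gpsi.
have ab : phi a = psi 0 by rewrite p1 q0.
pose chi := glue phi psi a c; pose kappa t := chi ((a + c) * t).
have chiL t : 0 <= t <= a -> chi t = phi t by exact: glue_left.
have chiR t : a <= t <= a + c -> chi t = psi (t - a).
  by apply: glue_right => //; exact: ltW.
have cA t : 0 <= t <= a + c -> A (chi t).
  move=> /andP[t0 tc]; have [ta|ta] := leP t a.
    by rewrite chiL ?t0//; apply: pA; rewrite in_itv/= t0.
  by rewrite chiR ?(ltW ta)//; apply: qA; rewrite in_itv/=; apply/andP; split; rewrite -/c; lra.
(* an overlap of the two halves would be a second meeting point *)
have chi_inj s t : 0 <= s <= a + c -> 0 <= t <= a + c -> chi s = chi t -> s = t.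
  wlog st : s t / s <= t => [H|].
    by case: (leP s t) => [/H//|/ltW ts] sI tI /esym h; apply/esym; exact: H h.
  move=> /andP[s0 sc] /andP[t0 tc].
  have [ta|ta] := leP t a.
    have sa := le_trans st ta.
    rewrite !chiL ?t0 ?s0//; apply: (arc_inj (geodesic_arc gphi)); rewrite ?s0 ?t0//.
  have [sa|sa] := leP s a; last first.
    rewrite !chiR ?(ltW ta) ?(ltW sa)// => h.
    suff : s - a = t - a by lra.
    by apply: (arc_inj (geodesic_arc gpsi) _ _ h); apply/andP; split; rewrite -/c; lra.
  rewrite chiL ?s0// chiR ?(ltW ta)// => h.
  have [A1 B1 _ _] := @geodesic_between _ _ _ s gphi ltac:(by rewrite s0).
  have [_ B2 E2 _] := @geodesic_between _ _ _ (t - a) gpsi ltac:(by apply/andP; split; rewrite -/c; lra).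
  have pb := only_b _ A1 B1 ltac:(by rewrite h).
  by move: E2; rewrite -h pb mdistxx; lra.
have ac0 : 0 < a + c by rewrite addr_gt0.
have kitv t : t \in `[0, 1] -> 0 <= (a + c) * t <= a + c.
  rewrite in_itv/= => /andP[t0 t1]; rewrite mulr_ge0 ?(ltW ac0)//=.
  by rewrite ler_piMr// ltW.
have [_ _ path_geo] := treeA.
have k0 : kappa 0 = u by rewrite /kappa mulr0 chiL ?lexx ?(ltW a0).
have k1 : kappa 1 = v.
  by rewrite /kappa mulr1 chiR ?lexx ?lerDl ?ltW// addrAC subrr add0r.
have [theta gtheta] := geodesic_exists Au Av.
have gtheta' : geodesic A (kappa 0) (kappa 1) theta by rewrite k0 k1.
have kE : kappa @` `[0, 1] = theta @` `[0, d (kappa 0) (kappa 1)].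
  apply: path_geo => //.
  - apply: continuous_subspaceT; apply: (@lipschitz_curve_continuous _ _ (a + c)) => s t.
    have := glue_nonexpansive ((a + c) * s) ((a + c) * t) (geodesic_arc gphi)
      (geodesic_arc gpsi) (ltW a0) (ltW c0) ab.
    by rewrite -mulrBr normrM (ger0_norm (ltW ac0)).
  - move=> s t; rewrite !inE => s1 t1 /(chi_inj _ _ (kitv _ s1) (kitv _ t1)).
    by apply: mulfI; rewrite gt_eqF.
  - by move=> t /kitv; exact: cA.
have : (kappa @` `[0, 1]) b.
  exists (a / (a + c)).
    by rewrite /= in_itv/= (divr_ge0 (ltW a0) (ltW ac0))/= ler_pdivrMr// mul1r lerDl ltW.
  by rewrite /kappa mulrC divfK ?gt_eqF// chiL ?lexx ?ltW.
rewrite kE k0 k1 => -[t /= tL <-].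
by have [] := @geodesic_between _ _ _ t gtheta ltac:(by move: tL; rewrite in_itv).
Qed.

(** Gluing the geodesics from [u] to [b] and from [b] to [v] gives a geodesic, and
    geodesics of a tree are unique. *)
Lemma between_geodesic u v b theta : A u -> A v -> A b ->
  geodesic A u v theta -> between u v b -> theta (d u b) = b.
Proof.
move=> Au Av Ab gtheta ubv.
have [phi gphi] := geodesic_exists Au Ab; have [psi gpsi] := geodesic_exists Ab Av.
pose a := d u b; pose c := d b v.
have a0 : 0 <= a by exact: mdist_ge0.
have c0 : 0 <= c by exact: mdist_ge0.
have [p0 p1 pA pd] := gphi; have [q0 q1 qA qd] := gpsi.
have ab : phi a = psi 0 by rewrite p1 q0.
pose chi := glue phi psi a c.
have chiL t : 0 <= t <= a -> chi t = phi t by exact: glue_left.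
have chiR t : a <= t <= a + c -> chi t = psi (t - a) by exact: glue_right.
have Lac : d u v = a + c by rewrite -ubv.
have chi0 : chi 0 = u by rewrite chiL ?lexx.
have chi1 : chi (a + c) = v.
  by rewrite chiR ?lerDl ?c0 ?lexx// addrAC subrr add0r.
have chi_le s t : d (chi s) (chi t) <= `|s - t|.
  by apply: glue_nonexpansive.
have gchi : geodesic A u v chi.
  split; rewrite ?Lac//.
    move=> t; rewrite in_itv/= => /andP[t0 tc]; have [ta|ta] := leP t a.
      by rewrite chiL ?t0//; apply: pA; rewrite in_itv/= t0.
    by rewrite chiR ?(ltW ta)//; apply: qA; rewrite in_itv/=; apply/andP; split; rewrite -/c; lra.
  move=> s t; rewrite !in_itv/=.
  wlog st : s t / s <= t => [H|].
    by case: (leP s t) => [/H//|/ltW ts] sI tI; rewrite metric_sym distrC; exact: H.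
  move=> /andP[s0 sc] /andP[t0 tc]; apply/eqP; rewrite eq_le chi_le/=.
  rewrite distrC ger0_norm ?subr_ge0//.
  have h0 := chi_le 0 s; rewrite chi0 sub0r normrN ger0_norm// in h0.
  have h1 := chi_le t (a + c); rewrite chi1 distrC ger0_norm ?subr_ge0// in h1.
  have h2 := metric_triangle u (chi s) v; have h3 := metric_triangle (chi s) (chi t) v.
  by move: h2; rewrite Lac; lra.
have [_ uniq _] := treeA.
rewrite (uniq u v theta chi)// ?chiL ?a0 ?lexx//.
by rewrite in_itv/= a0 Lac lerDl.
Qed.

Lemma between_le x z w : between x z w -> d x w <= d x z.
Proof. by rewrite /between => <-; rewrite lerDl mdist_ge0. Qed.

Lemma between_dist u v b p : A u -> A v -> A b -> A p ->
  between u v b -> between u v p -> d b p = `|d u b - d u p|.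
Proof.
move=> Au Av Ab Ap ub up; have [theta g] := geodesic_exists Au Av.
rewrite -[in LHS](between_geodesic Au Av Ab g ub) -[in LHS](between_geodesic Au Av Ap g up).
by rewrite (geodesic_arc g) ?mdist_ge0 ?between_le.
Qed.

(** The nearest-point projection on a segment is a gate: by minimality the
    geodesic to it meets the segment only there, so that the segment is entered
    through it. *)
Lemma between_projection y x z : A y -> A x -> A z ->
  exists b, [/\ A b, between x z b,
    (forall w, A w -> between x z w -> d y b <= d y w) &
    (forall w, A w -> between x z w -> d y w = d y b + d b w)].
Proof.
move=> Ay Ax Az; have [phi g] := geodesic_exists Ax Az.
have L0 : 0 <= d x z by exact: mdist_ge0.
pose f t := d y (phi (clamp (d x z) t)).
have fK s t : `|f s - f t| <= 1 * `|s - t|.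
  have h := arc_clamp_nonexpansive s t (geodesic_arc g) L0.
  rewrite mul1r (le_trans _ h)// ler_norml /f.
  have h1 := metric_triangle y (phi (clamp (d x z) s)) (phi (clamp (d x z) t)).
  have h2 := metric_triangle y (phi (clamp (d x z) t)) (phi (clamp (d x z) s)).
  by rewrite (metric_sym (phi (clamp (d x z) t))) in h2; apply/andP; split; lra.
have [r] := EVT_min L0 (continuous_subspaceT (lipschitz_continuous fK)).
rewrite in_itv/= => rL fr.
have [Ab bb xb bz] := geodesic_between g rL.
have min_b w : A w -> between x z w -> d y (phi r) <= d y w.
  move=> Aw bw; have := fr (d x w); rewrite in_itv/= mdist_ge0 (between_le bw) => /(_ isT).
  rewrite /f/= (clamp_id rL) clamp_id ?mdist_ge0 ?(between_le bw)//.
  by rewrite (between_geodesic Ax Az Aw g bw).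
exists (phi r); split => // w Aw bw; apply/esym.
apply: between_concat => // p Ap ybp bwp.
have bp : between x z p.
  have := between_dist Ax Az Ab Aw bb bw.
  have := metric_triangle x p z; have := metric_triangle x (phi r) p.
  have := metric_triangle p (phi r) z; have := metric_triangle x w p.
  have := metric_triangle p w z; rewrite (metric_sym p (phi r)).
  move: bb bw bwp; rewrite /between (metric_sym w p).
  by case: (ger0P (d x (phi r) - d x w)); lra.
have := min_b _ Ap bp; move: ybp; rewrite /between => h1 h2.
have : d p (phi r) = 0 by apply/eqP; rewrite eq_le mdist_ge0 andbT; lra.
by move/mdist_positivity.
Qed.

(** The Gromov product of [y] and [z] based at [x] is, in a tree, the distance
    from [x] to the projection of [y] on the segment from [x] to [z]. *)
Definition gromov x z y : R := (d x y + d x z - d y z) / 2.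

Lemma between_split u v p q : A u -> A v -> A p -> A q ->
  between u v q -> between u v p -> between u q p \/ between q v p.
Proof.
move=> Au Av Ap Aq uq up; have := between_dist Au Av Ap Aq up uq.
move: uq up; rewrite /between (metric_sym q p).
by case: (ger0P (d u p - d u q)) => ?; [right|left]; lra.
Qed.

(** A move from [y] by less than the distance to the segment does not touch the
    segment, hence does not change the projection. *)
Lemma gromov_locally_constant x z y : A x -> A z -> A y -> ~ between x z y ->
  exists2 r, 0 < r & forall y', A y' -> d y y' < r -> gromov x z y' = gromov x z y.
Proof.
move=> Ax Az Ay nxyz.
have [b [Ab xzb min_b gate]] := between_projection Ay Ax Az.
have bxx : between x z x by rewrite /between mdistxx add0r.
have bzz : between x z z by rewrite /between mdistxx addr0.
exists (d y b).
  by rewrite mdist_gt0; apply/eqP => yb; apply: nxyz; rewrite yb.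
move=> y' Ay' yy'.
have [c [Ac ybc _ gate']] := between_projection Ay' Ay Ab.
have y'y := gate' y Ay (ltac:(by rewrite /between mdistxx add0r)).
have y'b := gate' b Ab (ltac:(by rewrite /between mdistxx addr0)).
have y'w w : A w -> between x z w -> d y' w = d y' b + d b w.
  move=> Aw xzw; apply/esym; apply: between_concat => // p Ap y'bp bwp.
  have xzp : between x z p.
    have := between_dist Ax Az Ab Aw xzb xzw.
    have := metric_triangle x p z; have := metric_triangle x b p.
    have := metric_triangle p b z; have := metric_triangle x w p.
    have := metric_triangle p w z; rewrite (metric_sym p b).
    move: xzb xzw bwp; rewrite /between (metric_sym w p).
    by case: (ger0P (d x b - d x w)); lra.
  have pb0 : d y b <= d y p by exact: min_b.
  (* a second entry point p would lie either closer to y than b, or on the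
     segment from y to b *)
  have [h|h] := @between_split y' b p c Ay' Ab Ap Ac (esym y'b) y'bp.
    have := metric_triangle y c p; move: h; rewrite /between => h.
    have := mdist_ge0 y' p; rewrite (metric_sym c p) (metric_sym y c).
    by move=> ? ?; rewrite (metric_sym y y') in yy'; exfalso; lra.
  have ? := metric_triangle y c p; move: h ybc; rewrite /between => ? ?.
  have : d p b = 0 by apply/eqP; rewrite eq_le mdist_ge0 andbT; lra.
  by move/mdist_positivity.
have := gate x Ax bxx; have := gate z Az bzz; have := y'w x Ax bxx; have := y'w z Az bzz.
by rewrite /gromov (metric_sym y' x) (metric_sym y x) => -> -> -> ->; ring.
Qed.

(** The moved end [u'] projects on the segment from [x] to [u] beyond [z]. Far ends
    of segments can thus be taken in a dense set. *)
Lemma between_endpoint_near x u u' z : A x -> A u -> A u' -> A z ->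
  between x u z -> d u u' < d u z -> between x u' z /\ z <> u'.
Proof.
move=> Ax Au Au' Az xuz uu'.
have [c [Ac xuc _ gate]] := between_projection Au' Ax Au.
have := gate x Ax (ltac:(by rewrite /between mdistxx add0r)).
have := gate u Au (ltac:(by rewrite /between mdistxx addr0)).
have := gate z Az xuz; have := between_dist Ax Au Ac Az xuc xuz.
have ? := mdist_ge0 u' c.
move: xuc xuz uu'; rewrite /between (metric_sym u' u) (metric_sym u' z) (metric_sym u' x).
rewrite (metric_sym z u) (metric_sym c x) (metric_sym c u).
move=> ? ? uu' D ? ? ?; split; last by move=> zu'; move: uu'; rewrite zu' ltxx.
by move: D; case: (ger0P (d x c - d x z)) => ? ?; lra.
Qed.

(** The projection of [x] on the segment from [p] to [q] lies on one side of [z];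
    the other side leads away from [x]. *)
Lemma between_prolong x p q z : A x -> A p -> A q -> A z -> between p q z ->
  between x p z \/ between x q z.
Proof.
move=> Ax Ap Aq Az pqz.
have [b [Ab pqb _ gate]] := between_projection Ax Ap Aq.
have := gate p Ap (ltac:(by rewrite /between mdistxx add0r)).
have := gate q Aq (ltac:(by rewrite /between mdistxx addr0)).
have := gate z Az pqz; have := between_dist Ap Aq Ab Az pqb pqz.
move: pqb pqz; rewrite /between (metric_sym b p) (metric_sym z p).
by case: (ger0P (d p b - d p z)) => ? ? ? ? ? ?; [left|right]; lra.
Qed.

End tree_geometry.

(** * The length measure along a geodesic *)
Section length.
Context {R : realType} {X : pmetricType R} (rad : X -> R) (V : set X).
Implicit Types (phi c : R -> X) (L a b s t : R) (A : set X) (x y z u v : X).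
Local Notation B x := (ball x (rad x)).
Local Notation S := (skeleton rad).
Local Notation leb := (@lebesgue_measure R).

Context (rlow : R) (rlow0 : 0 < rlow) (radE : forall x, rlow <= rad x)
  (treeB : forall x, tree (B x)).

(** Open segments are countable unions of compact sets; this makes continuous
    curves measurable for the sigma-field generated by segments. *)
Lemma open_arc_bigcup phi L : phi @` `]0, L[ =
  \bigcup_n phi @` `[n.+1%:R^-1, L - n.+1%:R^-1].
Proof.
apply/seteqP; split => [_ [t /= + <-]|z [n _ [t /= + <-]]].
- rewrite in_itv/= => /andP[t0 tL].
  pose d := Num.min t (L - t).
  have d0 : 0 < d by rewrite lt_min t0 subr_gt0.
  exists (Num.bound d^-1) => //; exists t => //=.
  have : (Num.bound d^-1).+1%:R^-1 < d.
    rewrite -[ltRHS]invrK ltf_pV2 ?posrE ?invr_gt0//.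
    by rewrite (lt_le_trans (archi_boundP _)) ?ler_nat ?invr_ge0 ?(ltW d0).
  rewrite /d lt_min in_itv/=; move: _^-1 => k /andP[h1 h2].
  by apply/andP; split; lra.
- rewrite in_itv/= => /andP[t0 tL]; exists t => //=; rewrite in_itv/=.
  have n0 : 0 < n.+1%:R^-1 :> R by rewrite invr_gt0.
  by rewrite (lt_le_trans n0)//= (le_lt_trans tL)// ltrBlDr ltrDl.
Qed.

(** Short subsegments of a geodesic are open segments of the chart centred at
    their own origin, to which the length measure assigns their length. *)
Lemma short_oseg phi L a b : unit_arc phi L -> 0 <= a -> a <= b -> b <= L ->
  b - a < rlow -> oseg (B (phi a)) (phi a) (phi b) = phi @` `]a, b[.
Proof.
move=> phiL a0 ab bL abr.
have Bphi t : a <= t <= b -> B (phi a) (phi t).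
  move=> /andP[at_ tb]; apply/ball_mdist; rewrite phiL; [|apply/andP; split; lra..].
  by rewrite distrC ger0_norm ?subr_ge0// (lt_le_trans _ (radE _))//; lra.
rewrite (oseg_tree (treeB _) _ _ (geodesic_sub phiL a0 ab bL Bphi)).
- rewrite phiL; [|apply/andP; split; lra..].
  by rewrite distrC ger0_norm ?subr_ge0// arc_image_sub.
- by apply: Bphi; rewrite lexx.
- by apply: Bphi; rewrite lexx andbT.
Qed.

Lemma arc_skeleton phi L t : unit_arc phi L -> 0 < t < L -> S (phi t).
Proof.
move=> phiL /andP[t0 tL].
pose d := Num.min (Num.min t (L - t)) (rlow / 2) / 2.
have m0 : 0 < Num.min (Num.min t (L - t)) (rlow / 2).
  by rewrite !lt_min t0 subr_gt0 tL divr_gt0.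
have d0 : 0 < d by rewrite divr_gt0.
have : d < Num.min (Num.min t (L - t)) (rlow / 2).
  by rewrite ltr_pdivrMr// ltr_pMr// ltr1n.
rewrite !lt_min => /andP[/andP[dt dL] dr].
exists (phi (t - d)) => //; exists (phi (t + d)).
  apply/ball_mdist; rewrite phiL; [|apply/andP; split; lra..].
  by rewrite distrC ger0_norm; [apply: lt_le_trans (radE _)|]; lra.
rewrite (@short_oseg phi L) //; [|lra..].
by exists t => //=; rewrite in_itv/=; apply/andP; split; lra.
Qed.

Lemma continuous_measurable_arc c : continuous c ->
  @measurable_fun _ _ R (segType rad V) setT c.
Proof.
move=> cc; apply: (@measurability _ _ R (segType rad V) setT c (segments rad V) erefl).
move=> _ [_ [x [y [_ _ xy ->]]] <-]; rewrite setTI.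
have rx : 0 < rad x by rewrite (lt_le_trans rlow0).
have Bxx : B x x by exact: ballxx.
have Bxy : B x y by exact/ball_mdist.
have [phi gphi] : exists phi, geodesic (B x) x y phi.
  by have [+ _ _] := treeB x; apply.
have phiL := geodesic_arc gphi.
rewrite (oseg_tree (treeB x) Bxx Bxy gphi) open_arc_bigcup preimage_bigcup.
apply: bigcup_measurable => n _; apply: closed_measurable.
apply: closed_comp; first by move=> t _; exact: cc.
by apply: closed_arc phiL _ _ => //; rewrite lerBlDr lerDl.
Qed.

Context (nu : {measure set (segType rad V) -> \bar R}) (nulen : length_measure nu).
Local Notation segT := (segType rad V).
Local Notation measurableX A := (measurable (A : set segT)).

Lemma nu_short_arc phi L a b : unit_arc phi L -> 0 < a -> a <= b -> b < L ->
  b - a < rlow ->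
  measurableX (phi @` `]a, b[) /\ nu (phi @` `]a, b[) = (b - a)%:E.
Proof.
move=> phiL a0 ab bL abr.
have dE : mdist (phi a) (phi b) = b - a.
  rewrite phiL; [|apply/andP; split; lra..].
  by rewrite distrC ger0_norm// subr_ge0.
rewrite -(short_oseg phiL (ltW a0) ab (ltW bL) abr) -dE.
apply: nulen.2; rewrite ?dE ?(lt_le_trans abr)//.
- by apply: (arc_skeleton phiL); apply/andP; split; lra.
- by apply: (arc_skeleton phiL); apply/andP; split; lra.
Qed.

Lemma arc_image_disjoint phi L (A1 A2 : set R) : unit_arc phi L ->
  A1 `<=` `[0, L] -> A2 `<=` `[0, L] -> A1 `&` A2 = set0 ->
  phi @` A1 `&` phi @` A2 = set0.
Proof.
move=> phiL A1L A2L A12; rewrite -subset0 => _ [[s As <-] [t At ts]].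
suff st : t = s by have : (A1 `&` A2) s; [split; rewrite // -st|rewrite A12].
have := A1L _ As; have := A2L _ At; rewrite /= !in_itv/= => tL sL.
exact: arc_inj phiL tL sL ts.
Qed.

Lemma itv_split a b t : a < t < b ->
  `]a, b[%classic = (`]a, t[%classic `|` `]t, b[%classic) `|` [set t].
Proof.
move=> /andP[at_ tb]; apply/seteqP; split => [s|s [[|]|->]] /=; rewrite !in_itv/=.
- by move=> /andP[-> ->]; case: (ltgtP s t) => ?; [left;left|left;right|right].
- by move=> /andP[-> /lt_trans ->].
- by move=> /andP[/(lt_trans at_) -> ->].
- by rewrite at_ tb.
Qed.

Lemma nu_arc_split phi L a b t : unit_arc phi L -> 0 <= a -> b <= L -> a < t < b ->
  measurableX (phi @` `]a, t[) -> measurableX (phi @` `]t, b[) ->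
  measurableX [set phi t] ->
  measurableX (phi @` `]a, b[) /\
  nu (phi @` `]a, b[) =
    (nu (phi @` `]a, t[) + nu (phi @` `]t, b[) + nu [set phi t])%E.
Proof.
move=> phiL a0 bL /[dup] atb /andP[at_ tb] m1 m2 m3.
rewrite (itv_split atb) !image_setU image_set1; split.
  by do 2?apply: measurableU.
rewrite measureU//=; [|exact: measurableU|]; last first.
  rewrite -image_setU -image_set1; apply: (arc_image_disjoint phiL).
  - by move=> s [|] /=; rewrite !in_itv/= => /andP[? ?]; apply/andP; split; lra.
  - by move=> s /= ->; rewrite in_itv/=; apply/andP; split; lra.
  - by rewrite -subset0 => s [h /= st]; move: h; rewrite st /= !in_itv/= ltxx andbF; case.
congr (_ + _)%E; rewrite measureU//=; apply: (arc_image_disjoint phiL).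
- by move=> s /=; rewrite !in_itv/= => /andP[? ?]; apply/andP; split; lra.
- by move=> s /=; rewrite !in_itv/= => /andP[? ?]; apply/andP; split; lra.
- by rewrite -subset0 => s /= []; rewrite !in_itv/= => /andP[_ ?] /andP[? _]; lra.
Qed.

(** A short segment around the point and its two halves have lengths that add up,
    which leaves nothing to the point. *)
Lemma nu_arc_point phi L t : unit_arc phi L -> 0 < t < L ->
  measurableX [set phi t] /\ nu [set phi t] = 0%E.
Proof.
move=> phiL /andP[t0 tL].
pose d := Num.min (Num.min t (L - t)) (rlow / 2) / 2.
have m0 : 0 < Num.min (Num.min t (L - t)) (rlow / 2).
  by rewrite !lt_min t0 subr_gt0 tL divr_gt0.
have d0 : 0 < d by rewrite divr_gt0.
have : d < Num.min (Num.min t (L - t)) (rlow / 2).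
  by rewrite ltr_pdivrMr// ltr_pMr// ltr1n.
rewrite !lt_min => /andP[/andP[dt dL] dr].
have [m1 n1] := @nu_short_arc phi L (t - d) t phiL ltac:(lra) ltac:(lra) ltac:(lra) ltac:(lra).
have [m2 n2] := @nu_short_arc phi L t (t + d) phiL ltac:(lra) ltac:(lra) ltac:(lra) ltac:(lra).
have [m3 n3] := @nu_short_arc phi L (t - d) (t + d) phiL ltac:(lra) ltac:(lra) ltac:(lra) ltac:(lra).
have tdd : t - d < t < t + d by apply/andP; split; lra.
have mt : measurableX [set phi t].
  suff -> : [set phi t] = phi @` `]t - d, t + d[ `\` (phi @` `]t - d, t[ `|` phi @` `]t, t + d[).
    by apply: measurableD => //; exact: measurableU.
  rewrite -image_setU (itv_split tdd) (image_setU phi _ [set t]) image_set1 setDUl setDv set0U.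
  apply/esym/setDidPl; rewrite setIC -image_set1; apply: (arc_image_disjoint phiL).
  - by move=> s [|] /=; rewrite !in_itv/= => /andP[? ?]; apply/andP; split; lra.
  - by move=> s /= ->; rewrite in_itv/=; apply/andP; split; lra.
  - by rewrite -subset0 => s [h /= st]; move: h; rewrite st /= !in_itv/= ltxx andbF; case.
split=> //; have [_] := @nu_arc_split phi L (t - d) (t + d) t phiL ltac:(lra) ltac:(lra) tdd m1 m2 mt.
rewrite n1 n2 n3; case: (nu [set phi t]) => [r| |]//; rewrite -!EFinD => -[rE].
by congr EFin; lra.
Qed.

(** Long segments are cut into steps of length [rlow / 2]. *)
Lemma nu_arc_interior phi L a b : unit_arc phi L -> 0 < a -> a <= b -> b < L ->
  measurableX (phi @` `]a, b[) /\ nu (phi @` `]a, b[) = (b - a)%:E.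
Proof.
move=> phiL a0 ab bL.
have r20 : 0 < rlow / 2 by rewrite divr_gt0.
have [n] : exists n : nat, b - a < n.+1%:R * (rlow / 2).
  exists (Num.bound ((b - a) / (rlow / 2))); rewrite -ltr_pdivrMr//.
  rewrite (lt_le_trans (archi_boundP _)) ?ler_nat//.
  by rewrite divr_ge0 ?subr_ge0// ltW.
elim: n a a0 ab => [a a0 ab|n IH a a0 ab].
  by rewrite mul1r => ?; apply: (nu_short_arc phiL) => //; lra.
have [bar _|bar h] := ltP (b - a) rlow; first exact: (nu_short_arc phiL).
pose t := a + rlow / 2.
have atb : a < t < b by apply/andP; rewrite /t; split; lra.
have [at_ tb] := andP atb.
have [m1 n1] : measurableX (phi @` `]a, t[) /\ nu (phi @` `]a, t[) = (t - a)%:E.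
  by apply: (nu_short_arc phiL) => //; rewrite ?ltW//; rewrite /t; lra.
have [m2 n2] : measurableX (phi @` `]t, b[) /\ nu (phi @` `]t, b[) = (b - t)%:E.
  apply: IH; [lra|lra|].
  by move: h; rewrite -[in X in X -> _]natr1 mulrDl mul1r /t; lra.
have [m3 n3] := @nu_arc_point phi L t phiL ltac:(apply/andP; split; lra).
have [m4 n4] := nu_arc_split phiL (ltW a0) (ltW bL) atb m1 m2 m3.
by split=> //; rewrite n4 n1 n2 n3 -!EFinD; congr EFin; ring.
Qed.

(** The ends of the geodesic may lie off the skeleton, hence an exhaustion by
    interior segments. *)
Lemma nu_arc_itv phi L a b : unit_arc phi L -> 0 <= a -> a <= b -> b <= L ->
  measurableX (phi @` `]a, b[) /\ nu (phi @` `]a, b[) = (b - a)%:E.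
Proof.
move=> phiL a0 ab bL.
pose e (n : nat) : R := (b - a) / 2 * n.+1%:R^-1.
have e2 n : 2 * e n <= b - a.
  have k1 : n.+1%:R^-1 <= 1 :> R by rewrite invf_le1 ?ler1n.
  rewrite /e; move: _^-1 k1 => k k1.
  have -> : 2 * ((b - a) / 2 * k) = (b - a) * k by field.
  by rewrite ler_piMr// subr_ge0.
have [->|/eqP ab'] := eqVneq a b.
  by rewrite set_itv_ge ?bnd_simp ?ltxx// image_set0 measure0 subrr; split.
have {}ab : a < b by rewrite lt_neqAle ab andbT; apply/eqP.
have e0' n : 0 < e n by rewrite mulr_gt0 ?invr_gt0 ?divr_gt0 ?subr_gt0.
pose I n := phi @` `]a + e n, b - e n[.
have IE n : measurableX (I n) /\ nu (I n) = (b - e n - (a + e n))%:E.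
  have := e2 n; have := e0' n => ? ?.
  by apply: (nu_arc_interior phiL); lra.
have UI : phi @` `]a, b[ = \bigcup_n I n.
  apply/seteqP; split => [_ [t /= + <-]|_ [n _ [t /= + <-]]]; rewrite in_itv/=.
    move=> /andP[at_ tb].
    pose d := Num.min (t - a) (b - t).
    have d0 : 0 < d by rewrite lt_min !subr_gt0 at_ tb.
    pose n := Num.bound (d^-1 * ((b - a) / 2)).
    have : e n < d.
      rewrite /e ltr_pdivrMr// -ltr_pdivrMl//.
      rewrite (lt_le_trans (archi_boundP _)) ?ler_nat//.
      by rewrite mulr_ge0 ?invr_ge0 ?divr_ge0 ?subr_ge0// ltW.
    rewrite /d lt_min => /andP[h1 h2]; exists n => //; exists t => //=.
    by rewrite in_itv/=; apply/andP; split; lra.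
  move=> /andP[at_ tb]; exists t => //=; rewrite in_itv/=.
  by have := e0' n => ?; apply/andP; split; lra.
have mU : measurableX (\bigcup_n I n).
  by apply: bigcup_measurable => n _; exact: (IE n).1.
rewrite UI; split => //.
have ndI : {homo I : n m / (n <= m)%N >-> (n <= m)%O}.
  move=> n m nm; apply/subsetPset => _ [t /= + <-]; rewrite in_itv/=.
  have emn : e m <= e n.
    by rewrite /e ler_wpM2l ?divr_ge0 ?subr_ge0 ?(ltW ab)// lef_pV2 ?posrE ?ler_nat.
  move=> /andP[? ?]; exists t => //=; rewrite in_itv/=; apply/andP; split; lra.
have h1 := @nondecreasing_cvg_mu _ segT R nu I (fun n => (IE n).1) mU ndI.
apply: (cvg_unique _ h1); first exact: ereal_hausdorff.
apply: cvg_EFin; first by near=> n; rewrite /= (IE n).2.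
rewrite [X in X @ _ --> _](_ : _ = (fun n => b - e n - (a + e n))); last first.
  by apply/funext => n /=; rewrite (IE n).2.
have ecvg : e @ \oo --> (0 : R).
  rewrite -(mulr0 ((b - a) / 2)).
  exact: (cvgM (cvg_cst ((b - a) / 2)) (@cvg_harmonic R)).
have -> : b - a = b - 0 - (a + 0) by rewrite subr0 addr0.
apply: (@cvgB _ R^o); [apply: (@cvgB _ R^o)|apply: (@cvgD _ R^o)] => //; exact: cvg_cst.
Unshelve. all: by end_near. Qed.

Local Notation theta phi := (mdist (phi 0%R)).

Lemma arc_dist_start phi L t : unit_arc phi L -> 0 <= t <= L ->
  mdist (phi 0) (phi t) = t.
Proof.
move=> phiL /andP[t0 tL]; rewrite phiL ?t0 ?lexx ?(le_trans t0)//.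
by rewrite sub0r normrN ger0_norm.
Qed.

(** The distance to the origin inverts the geodesic, so that images of sets along
    the geodesic are preimages. *)
Lemma arc_imageE phi L (E : set R) : unit_arc phi L ->
  phi @` (E `&` `]0, L[) = phi @` `]0, L[ `&` (theta phi @^-1` E).
Proof.
move=> phiL; apply/seteqP; split => [_ [t [Et /= tL] <-]|_ [[t /= tL <-] Et]].
  split; first by exists t.
  rewrite /= (arc_dist_start phiL)//.
  by move: tL; rewrite in_itv/= => /andP[/ltW -> /ltW ->].
exists t => //; split => //; move: Et; rewrite (arc_dist_start phiL)//.
by move: tL; rewrite in_itv/= => /andP[/ltW -> /ltW ->].
Qed.

Lemma ray_itvI (r L : R) : `]r, +oo[ `&` `]0, L[ = `]Num.max 0 r, L[%classic.
Proof.
apply/seteqP; split => t /=; rewrite !in_itv/= gt_max andbT.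
  by move=> [-> /andP[-> ->]].
by move=> /andP[/andP[-> ->] ->].
Qed.

Lemma measurable_open_arc phi L : unit_arc phi L -> measurableX (phi @` `]0, L[).
Proof.
move=> phiL; have [L0|L0] := leP 0 L.
  by have [] := @nu_arc_itv phi L 0 L phiL (lexx _) L0 (lexx _).
by rewrite set_itv_ge ?bnd_simp -?leNgt ?ltW// image_set0; exact: measurable0.
Qed.

Lemma nu_arc_ray phi L r : unit_arc phi L ->
  measurableX (phi @` (`]r, +oo[ `&` `]0, L[)) /\
  nu (phi @` (`]r, +oo[ `&` `]0, L[)) = leb (`]r, +oo[ `&` `]0, L[).
Proof.
move=> phiL; rewrite ray_itvI; have [h|h] := leP (Num.max 0 r) L.
  have [] := @nu_arc_itv phi L (Num.max 0 r) L phiL _ h (lexx _).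
    by rewrite le_max lexx.
  move=> m1 ->; split => //; rewrite lebesgue_measure_itv/= lte_fin.
  case: ltP => [//|h']; have -> : L = Num.max 0 r by apply/eqP; rewrite eq_le h h'.
  by rewrite subrr.
by rewrite set_itv_ge ?bnd_simp -?leNgt ?ltW// image_set0 !measure0; split => //; exact: measurable0.
Qed.

Lemma measurable_arc_dist phi L : unit_arc phi L ->
  @measurable_fun _ _ segT R (phi @` `]0, L[) (theta phi).
Proof.
move=> phiL.
apply: (@measurability _ _ segT R (phi @` `]0, L[) (theta phi) _ (RGenOInfty.measurableE R)).
move=> _ [_ [r ->] <-]; rewrite -arc_imageE//.
exact: (nu_arc_ray r phiL).1.
Qed.

Lemma measurable_arc_image phi L (E : set R) : unit_arc phi L -> measurable E ->
  measurableX (phi @` (E `&` `]0, L[)).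
Proof.
move=> phiL mE; rewrite arc_imageE//.
exact: (measurable_arc_dist phiL (measurable_open_arc phiL) mE).
Qed.

(** Along a geodesic the length measure is the Lebesgue measure: the two measures
    agree on rays. *)
Lemma nu_arc_image phi L (E : set R) : unit_arc phi L -> measurable E ->
  nu (phi @` (E `&` `]0, L[)) = leb (E `&` `]0, L[).
Proof.
move=> phiL mE.
have mU := measurable_open_arc phiL.
pose th : segT -> R := (theta phi : segT -> R) \_ (phi @` `]0, L[).
have mth : @measurable_fun _ _ segT (measurableTypeR R) setT th.
  exact: ((measurable_restrictT _ mU).1 (measurable_arc_dist phiL)).
have thE (A : set R) : th @^-1` A `&` (phi @` `]0, L[) = phi @` (A `&` `]0, L[).
  rewrite arc_imageE// setIC; apply/seteqP; split => z [Uz]; rewrite /= /th patchE mem_set//.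
pose push : {measure set (measurableTypeR R) -> \bar R} :=
  @pushforward _ _ segT (measurableTypeR R) R (mrestr nu mU) th.
pose m1 := push mth.
have mI : measurable (`]0, L[ : set R) by exact: measurable_itv.
pose m2 : {measure set (measurableTypeR R) -> \bar R} := mrestr leb mI.
have m1E (A : set R) : m1 A = nu (phi @` (A `&` `]0, L[)).
  by rewrite -thE.
rewrite -m1E.
pose g (n : nat) : set R := `]- n%:R, +oo[%classic.
have := @measure_unique _ R (measurableTypeR R) (@RGenOInfty.G R) g
  (RGenOInfty.measurableE R) _ _ _ m1 m2 _ _ E mE.
apply.
- move=> _ _ [x ->] [y ->]; exists (Num.max x y).
  by apply/seteqP; split => t /=; rewrite !in_itv/= gt_max !andbT; [case=> -> ->|case/andP].
- by move=> n; exists (- n%:R).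
- rewrite -subTset => x _; exists (Num.bound `|x|) => //=.
  have := archi_boundP (normr_ge0 x); rewrite ltr_norml => /andP[h1 h2].
  by rewrite /g /= in_itv/= h1.
- move=> _ [r ->]; have := (nu_arc_ray r phiL).2.
  by rewrite -m1E.
- move=> n; rewrite m1E (nu_arc_ray _ phiL).2 ray_itvI lebesgue_measure_itv/=.
  by case: ifP => _; rewrite ?ltry// -EFinD ltry.
Qed.

Lemma arc_clamp_preimage phi L (A : set X) : unit_arc phi L -> 0 <= L ->
  A `<=` phi @` `]0, L[ ->
  (phi \o clamp L) @^-1` A `<=` `]0, L[.
Proof.
move=> phiL L0 AU t /= /AU[s /= + st]; rewrite in_itv/= => /andP[s0 sL].
have := arc_inj phiL _ (clamp_itv t L0) st.
rewrite (ltW s0) (ltW sL) => /(_ isT) sE.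
move: s0 sL; rewrite {}sE /clamp in_itv/=.
case: (leP t L) => ?; case: (leP 0 t) => ?; case: (leP 0 L) => ?; move=> ? ?;
  apply/andP; split; lra.
Qed.

Lemma arc_clamp_preimage_open phi L : unit_arc phi L -> 0 <= L ->
  (phi \o clamp L) @^-1` (phi @` `]0, L[) = `]0, L[%classic.
Proof.
move=> phiL L0; apply/seteqP; split; first exact: arc_clamp_preimage.
move=> t /[dup] tL /=; rewrite in_itv/= => /andP[t0 tL'].
by exists t => //; rewrite clamp_id// (ltW t0) ltW.
Qed.

Lemma nu_sub_arc phi L (A : set segT) : unit_arc phi L -> 0 <= L ->
  measurable A -> A `<=` phi @` `]0, L[ ->
  nu A = leb ((phi \o clamp L) @^-1` A).
Proof.
move=> phiL L0 mA AU.
have mE : measurable ((phi \o clamp L) @^-1` A).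
  rewrite -[X in measurable X]setTI.
  exact: (continuous_measurable_arc (arc_clamp_continuous phiL L0) measurableT mA).
have Esub := arc_clamp_preimage phiL L0 AU.
rewrite -[in RHS](setIidl Esub) -(nu_arc_image phiL mE); congr (nu _).
apply/seteqP; split => [z Az|_ [t [At tL] <-]].
  have [t tL tz] := AU z Az; exists t => //; split => //=.
  by rewrite clamp_id ?tz//; move: tL; rewrite /= in_itv/= => /andP[/ltW -> /ltW].
by move: At tL; rewrite /= in_itv/= => + /andP[/ltW ? /ltW ?]; rewrite clamp_id//; apply/andP.
Qed.

(** On subsets of the segment, [nu] is the image of the Lebesgue measure by the
    clamped geodesic. *)
Lemma ge0_arc_integral phi L (f : X -> \bar R) : unit_arc phi L -> 0 <= L ->
  @measurable_fun _ _ segT _ (phi @` `]0, L[) f ->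
  (forall z, 0 <= f z)%E ->
  (\int[nu]_(z in phi @` `]0%R, L[) f z = \int[leb]_(t in `]0%R, L[) f (phi t))%E.
Proof.
move=> phiL L0 mf f0.
have mc := continuous_measurable_arc (arc_clamp_continuous phiL L0).
have mU := measurable_open_arc phiL.
pose push : {measure set segT -> \bar R} :=
  @pushforward _ _ (measurableTypeR R) segT R leb (phi \o clamp L).
rewrite (@eq_measure_integral _ segT R _ (push mc)); last first.
  by move=> A mA AU; exact: nu_sub_arc.
rewrite (@ge0_integral_pushforward _ _ (measurableTypeR R) segT R _ mc leb _ f)//.
rewrite arc_clamp_preimage_open//.
apply: eq_integral => t; rewrite inE/= in_itv/= => /andP[/ltW t0 /ltW tL].
by rewrite clamp_id// t0.
Qed.

Lemma arc_integral phi L (f : X -> \bar R) : unit_arc phi L -> 0 <= L ->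
  @measurable_fun _ _ segT _ (phi @` `]0, L[) f ->
  (\int[nu]_(z in phi @` `]0%R, L[) f z = \int[leb]_(t in `]0%R, L[) f (phi t))%E.
Proof.
move=> phiL L0 mf; rewrite [LHS]integralE [RHS]integralE.
rewrite !ge0_arc_integral//.
- congr (_ - _)%E; apply: eq_integral => t _.
    by rewrite -[RHS]/((f \o phi)^\+%E t) [in RHS]funepos_comp.
  by rewrite -[RHS]/((f \o phi)^\-%E t) [in RHS]funeneg_comp.
- exact: (measurable_funeneg mf).
- exact: (measurable_funepos mf).
Qed.

Lemma measurable_along_arc d (T : measurableType d) phi L (g : X -> T) :
  unit_arc phi L -> 0 <= L -> @measurable_fun _ _ segT _ (phi @` `]0, L[) g ->
  measurable_fun `]0, L[ (g \o phi).
Proof.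
move=> phiL L0 mg.
have mc := continuous_measurable_arc (arc_clamp_continuous phiL L0).
have mU := measurable_open_arc phiL.
apply: (eq_measurable_fun (g \o (phi \o clamp L))).
  move=> t; rewrite inE/= in_itv/= => /andP[/ltW t0 /ltW tL].
  by rewrite clamp_id// t0.
rewrite -(arc_clamp_preimage_open phiL L0) => mE Y mY.
have := mc measurableT _ (mg mU _ mY).
by rewrite setTI.
Qed.

Lemma measurable_from_arc d (T : measurableType d) phi L (g : X -> T) :
  unit_arc phi L -> measurable_fun `]0, L[ (g \o phi) ->
  @measurable_fun _ _ segT _ (phi @` `]0, L[) g.
Proof.
move=> phiL mg mU Y mY.
have mE := mg (measurable_itv _) _ mY.
have := measurable_arc_image phiL mE; congr (measurable _).
apply/seteqP; split => [_ [t [[tL Yt] _] <-]|_ [[t tL <-] Yt]].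
  by split => //; exists t.
by exists t.
Qed.

Lemma integrable_along_arc phi L (f : X -> \bar R) : unit_arc phi L -> 0 <= L ->
  nu.-integrable (phi @` `]0, L[) f -> leb.-integrable `]0, L[ (f \o phi).
Proof.
move=> phiL L0 /integrableP[mf intf]; apply/integrableP; split.
  exact: measurable_along_arc.
rewrite -(@ge0_arc_integral phi L (fun z => `|f z|%E))//.
exact: measurableT_comp.
Qed.

Lemma negligible_arc phi L (N : set R) : unit_arc phi L ->
  leb.-negligible N -> nu.-negligible (phi @` (N `&` `]0, L[)).
Proof.
move=> phiL [M [mM M0 NM]]; exists (phi @` (M `&` `]0, L[)); split.
- exact: measurable_arc_image.
- rewrite [LHS](nu_arc_image phiL mM); apply/eqP; rewrite eq_le measure_ge0 andbT -[leRHS]M0.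
  by rewrite le_measure ?inE//; apply: measurableI => //; exact: measurable_itv.
- by apply: image_subset; exact: setSI.
Qed.

Lemma skeleton_point z : S z -> measurableX [set z] /\ nu [set z] = 0%E.
Proof.
move=> [a _ [b _ [phi gphi [t /= tL <-]]]].
by apply: (nu_arc_point (geodesic_arc gphi)); move: tL; rewrite in_itv.
Qed.

(** * The skeleton in a chart *)
Context (e : nat -> X) (e_dense : forall x r, 0 < r -> exists n, mdist x (e n) < r).

Lemma radP x : 0 < rad x. Proof. exact: lt_le_trans rlow0 (radE x). Qed.

Lemma ball_self x : B x x. Proof. exact: ballxx (radP x). Qed.

Definition geo x u : R -> X :=
  if pselect (exists phi, geodesic (B x) x u phi) is left h
  then projT1 (cid h) else cst x.

Lemma geoP x u : B x u -> geodesic (B x) x u (geo x u).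
Proof.
move=> Bu; rewrite /geo; case: pselect => [h|[]]; first by case: cid.
exact: (geodesic_exists (treeB x) (ball_self x) Bu).
Qed.

Lemma geo_arc x u : B x u -> unit_arc (geo x u) (mdist x u).
Proof. by move=> /geoP; exact: geodesic_arc. Qed.

Lemma geo0 x u : B x u -> geo x u 0 = x.
Proof. by move=> /geoP[]. Qed.

Lemma geo1 x u : B x u -> geo x u (mdist x u) = u.
Proof. by move=> /geoP[]. Qed.

Lemma geo_ball x u t : B x u -> 0 <= t <= mdist x u -> B x (geo x u t).
Proof. by move=> /geoP[_ _ + _] tL; apply; rewrite in_itv. Qed.

Lemma geo_dist x u t : B x u -> 0 <= t <= mdist x u -> mdist x (geo x u t) = t.
Proof. by move=> /geoP /geodesic_between h /h[]. Qed.

Lemma geo_initial x u s t : B x u -> 0 <= s -> s <= t -> t <= mdist x u ->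
  geo x (geo x u t) s = geo x u s.
Proof.
move=> Bu s0 st tu; have t0 := le_trans s0 st.
have tI : 0 <= t <= mdist x u by rewrite t0.
have Bt := geo_ball Bu tI; have [_ uniq _] := treeB x.
apply: (uniq x (geo x u t)) => //.
- exact: ball_self.
- exact: geoP.
- have [_ _ _ gd] := geoP Bu.
  split; rewrite ?geo_dist// ?geo0//.
    move=> r; rewrite in_itv/= => /andP[r0 rt]; apply: geo_ball => //.
    by rewrite r0 (le_trans rt).
  move=> r q; rewrite !in_itv/= => /andP[r0 rt] /andP[q0 qt].
  by apply: geo_arc => //; rewrite ?r0 ?q0 /= (le_trans _ tu).
- by rewrite geo_dist// in_itv/= s0.
Qed.

Lemma oseg_geo x u : B x u -> oseg (B x) x u = geo x u @` `]0, mdist x u[.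
Proof. by move=> Bu; apply: oseg_tree => //; [exact: ball_self|exact: geoP]. Qed.

Lemma oseg_outside x u : ~ B x u -> oseg (B x) x u = set0.
Proof.
move=> nBu; rewrite -subset0 => z [phi [_ p1 pA _] _]; apply: nBu.
by rewrite -p1; apply: pA; rewrite in_itv/= mdist_ge0 lexx.
Qed.

Lemma oseg_in_chart x u v : B x u -> B x v ->
  [/\ oseg (B x) u v `<=` S `&` B x, measurableX (oseg (B x) u v) &
     nu (oseg (B x) u v) = (mdist u v)%:E].
Proof.
move=> Bu Bv; have [phi g] := geodesic_exists (treeB x) Bu Bv.
have gL := geodesic_arc g.
rewrite (oseg_tree (treeB x) Bu Bv g).
have [m1 n1] := nu_arc_itv gL (lexx 0) (mdist_ge0 u v) (lexx _).
rewrite subr0 in n1; split => // _ [t /= tL <-]; split.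
  by apply: (arc_skeleton gL); move: tL; rewrite in_itv.
have [_ _ pA _] := g; apply: pA; move: tL; rewrite !in_itv/=.
by move=> /andP[/ltW -> /ltW ->].
Qed.

(** A short segment through [z] leads away from [x] on one side; a point of the
    dense sequence near its far end then lies beyond [z] as well. *)
Lemma skeleton_spoke x z : S z -> B x z -> z <> x ->
  exists2 n, B x (e n) & oseg (B x) x (e n) z.
Proof.
move=> [a _ [b Bab [phi gphi [t /= + zE]]]] Bz zx.
rewrite in_itv/= => /andP[t0 tL]; have phiL := geodesic_arc gphi.
set L := mdist a b in tL phiL.
have xz : mdist x z < rad x by exact/ball_mdist.
pose m := Num.min (Num.min t (L - t)) (rad x - mdist x z).
have m0 : 0 < m by rewrite !lt_min t0 !subr_gt0 tL.
pose d := m / 2; have d0 : 0 < d by rewrite divr_gt0.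
have : d < m by rewrite ltr_pdivrMr// ltr_pMr// ltr1n.
rewrite !lt_min => /andP[/andP[dt dL] dr].
have pz : mdist (phi (t - d)) z = d.
  rewrite -zE phiL; [|apply/andP; split; lra..].
  have -> : t - d - t = - d by ring.
  by rewrite normrN ger0_norm// ltW.
have qz : mdist z (phi (t + d)) = d.
  rewrite -zE phiL; [|apply/andP; split; lra..].
  have -> : t - (t + d) = - d by ring.
  by rewrite normrN ger0_norm// ltW.
have pq : mdist (phi (t - d)) (phi (t + d)) = d + d.
  rewrite phiL; [|apply/andP; split; lra..].
  have -> : t - d - (t + d) = - (d + d) by ring.
  by rewrite normrN ger0_norm//; lra.
have Bp : B x (phi (t - d)).
  apply/ball_mdist; apply: le_lt_trans (metric_triangle _ z _) _.
  by rewrite (metric_sym z) pz; lra.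
have Bq : B x (phi (t + d)).
  apply/ball_mdist; apply: le_lt_trans (metric_triangle _ z _) _.
  by rewrite qz; lra.
have [u [Bu xuz zu]] : exists u, [/\ B x u, between x u z & 0 < mdist u z].
  have pqz : between (phi (t - d)) (phi (t + d)) z by rewrite /between pz qz pq.
  have [h|h] := between_prolong (treeB x) (ball_self x) Bp Bq Bz pqz.
    by exists (phi (t - d)); rewrite pz.
  by exists (phi (t + d)); rewrite metric_sym qz.
have xu : mdist x u < rad x by exact/ball_mdist.
have m'0 : 0 < Num.min (mdist u z) (rad x - mdist x u).
  by rewrite lt_min zu subr_gt0 xu.
have [n] := e_dense u m'0; rewrite lt_min => /andP[n1 n2].
have Bn : B x (e n).
  by apply/ball_mdist; apply: le_lt_trans (metric_triangle _ u _) _; lra.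
have [xnz zn] := between_endpoint_near (treeB x) (ball_self x) Bu Bn Bz xuz n1.
exists n => //; rewrite (oseg_geo Bn); exists (mdist x z); last first.
  exact: (between_geodesic (treeB x) (ball_self x) Bn Bz (geoP Bn) xnz).
have xz0 : 0 < mdist x z by rewrite mdist_gt0; apply/eqP => /esym.
have zn0 : 0 < mdist z (e n) by rewrite mdist_gt0; exact/eqP.
by rewrite /= in_itv/= xz0 -xnz ltrDl.
Qed.

Lemma skeleton_ballE x : S `&` B x =
  \bigcup_n oseg (B x) x (e n) `|` (S `&` [set x]).
Proof.
apply/seteqP; split => [z [Sz Bz]|z [[n _ zn]|[Sz /= zx]]].
- have [zx|/eqP zx] := eqVneq z x; first by right.
  by have [n Bn zn] := skeleton_spoke Sz Bz zx; left; exists n.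
- have [Bn|nBn] := pselect (B x (e n)).
    by have [+ _ _] := oseg_in_chart (ball_self x) Bn; apply.
  by move: zn; rewrite oseg_outside.
- by split => //; rewrite zx; exact: ball_self.
Qed.

Lemma measurable_spoke x n : measurableX (oseg (B x) x (e n)).
Proof.
have [Bn|nBn] := pselect (B x (e n)).
  by have [] := oseg_in_chart (ball_self x) Bn.
by rewrite oseg_outside//; exact: measurable0.
Qed.

Lemma skeleton_center x : S `&` [set x] = set0 \/
  [/\ S x, S `&` [set x] = [set x], measurableX [set x] & nu [set x] = 0%E].
Proof.
have [Sx|nSx] := pselect (S x); last first.
  by left; rewrite -subset0 => z [+ zx]; rewrite zx.
have [] := skeleton_point Sx; right; split => //.
by apply/seteqP; split => [z []|z ->].
Qed.

Lemma measurable_skeleton_ball x : measurableX (S `&` B x).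
Proof.
rewrite skeleton_ballE; apply: measurableU.
  by apply: bigcup_measurable => n _; exact: measurable_spoke.
by case: (skeleton_center x) => [->|[_ -> ? _]]//; exact: measurable0.
Qed.

Lemma skeletonE : S = \bigcup_n (S `&` B (e n)).
Proof.
apply/seteqP; split => [z Sz|z [n _ []]//].
have [n zn] := e_dense z rlow0; exists n => //; split => //.
by apply/ball_mdist; rewrite metric_sym (lt_le_trans zn).
Qed.

Lemma measurable_skeleton : measurableX S.
Proof.
by rewrite skeletonE; apply: bigcup_measurable => n _; exact: measurable_skeleton_ball.
Qed.

(** The two reductions below turn almost everywhere statements on the skeleton
    into statements on intervals of the real line. *)
Lemma negligible_skeleton_ball x (P : set X) :
  (forall u, B x u -> leb.-negligible [set t | (t \in `]0, mdist x u[) /\ P (geo x u t)]) ->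
  nu.-negligible (S `&` B x `&` P).
Proof.
move=> H; rewrite skeleton_ballE setIUl; apply: negligibleU; last first.
  case: (skeleton_center x) => [->|[_ -> mx n0]].
    by rewrite set0I; exact: negligible_set0.
  exists [set x]; split => //; exact: subIsetl.
rewrite setI_bigcupl; apply: negligible_bigcup => n.
have [Bn|nBn] := pselect (B x (e n)); last first.
  by rewrite oseg_outside// set0I; exact: negligible_set0.
apply: negligibleS (negligible_arc (geo_arc Bn) (H _ Bn)).
rewrite oseg_geo// => _ [[t tL <-] Pt]; exists t => //; split => //; split => //.
Qed.

Lemma negligible_skeleton (P : set X) :
  (forall x, nu.-negligible (S `&` B x `&` P)) -> nu.-negligible (S `&` P).
Proof.
move=> H; rewrite skeletonE setI_bigcupl; apply: negligible_bigcup => n.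
exact: H.
Qed.

(** The ends of the segment contribute null points, or nothing when they lie off
    the skeleton. *)
Lemma segment_trace x u : B x u ->
  measurableX (S `&` [set z | between x u z]) /\
  (nu (S `&` [set z | between x u z]) <= (mdist x u)%:E)%E.
Proof.
move=> Bu; have [sub mo no] := oseg_in_chart (ball_self x) Bu.
have point z : measurableX (S `&` [set z]) /\ nu (S `&` [set z]) = 0%E.
  have [->|[_ -> //]] := skeleton_center z.
  by rewrite measure0; split => //; exact: measurable0.
have [mx nx] := point x; have [mu_ nu_] := point u.
have -> : S `&` [set z | between x u z] =
    oseg (B x) x u `|` ((S `&` [set x]) `|` (S `&` [set u])).
  apply/seteqP; split => [z [Sz xuz]|z].
    have [zx|/eqP zx] := eqVneq z x; first by right; left.
    have [zu|/eqP zu] := eqVneq z u; first by right; right.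
    left; rewrite oseg_geo//; exists (mdist x z); last first.
      apply: (between_geodesic (treeB x) (ball_self x) Bu _ (geoP Bu) xuz).
      by apply/ball_mdist; apply: le_lt_trans (between_le xuz) _; apply/ball_mdist.
    have xz0 : 0 < mdist x z by rewrite mdist_gt0; apply/eqP => /esym.
    have zu0 : 0 < mdist z u by rewrite mdist_gt0; exact/eqP.
    by rewrite /= in_itv/= xz0 -xuz ltrDl.
  move=> [zo|[[Sz /= zE]|[Sz /= zE]]].
  - have [Sz _] := sub z zo; split => //.
    move: zo; rewrite oseg_geo// => -[t tL <-].
    have tI : 0 <= t <= mdist x u.
      by move: tL; rewrite /= in_itv/= => /andP[/ltW -> /ltW ->].
    by have [] := geodesic_between (geoP Bu) tI.
  - by split => //=; rewrite zE /between mdistxx add0r.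
  - by split => //=; rewrite zE /between mdistxx addr0.
split; first by apply: measurableU => //; exact: measurableU.
apply: le_trans (measureU2 _ _ _) _ => //; first exact: measurableU.
rewrite [X in (X + _ <= _)%E]no -[leRHS]adde0 leeD2l//.
apply: le_trans (measureU2 _ _ _) _ => //.
by rewrite [X in (X + _ <= _)%E]nx [X in (_ + X <= _)%E]nu_ adde0.
Qed.

Lemma measurable_fun_skeleton_ball d (T : measurableType d) x (g : X -> T) :
  (forall u, B x u -> @measurable_fun _ _ segT _ (oseg (B x) x u) g) ->
  @measurable_fun _ _ segT _ (S `&` B x) g.
Proof.
move=> H; rewrite skeleton_ballE; apply/measurable_funU => //.
- by apply: bigcup_measurable => n _; exact: measurable_spoke.
- by case: (skeleton_center x) => [->|[_ -> ? _]]//; exact: measurable0.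
split.
  apply/measurable_fun_bigcup => n; first exact: measurable_spoke.
  have [Bn|nBn] := pselect (B x (e n)); first exact: H.
  by rewrite oseg_outside//; exact: measurable_fun_set0.
case: (skeleton_center x) => [->|[_ -> ? _]]; first exact: measurable_fun_set0.
exact: measurable_fun_set1.
Qed.

(** * Gradients of Lipschitz functions *)
Definition along (f : X -> R) x u (t : R) := f (geo x u (clamp (mdist x u) t)).

Lemma alongE f x u t : 0 <= t <= mdist x u -> along f x u t = f (geo x u t).
Proof. by move=> tL; rewrite /along clamp_id. Qed.

Lemma itv_oo_cc t L : t \in `]0, L[ -> 0 <= t <= L.
Proof. by rewrite in_itv/= => /andP[/ltW -> /ltW ->]. Qed.

(** Geodesics from the centre [x] of the chart turn the integral formula that
    defines a weak gradient into the one of a primitive on an interval. *)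
Lemma weak_gradient_slope x u f (g : segT -> R) : weak_gradient nu x f g -> B x u ->
  {ae leb, forall t, t \in `]0, mdist x u[ -> has_slope (along f x u) t (g (geo x u t))}.
Proof.
move=> [mg gint fE] Bu.
apply: (@primitive_has_slope _ (along f x u) (g \o geo x u)).
  have := gint x u (ball_self x) Bu; rewrite oseg_geo// => h.
  exact: (integrable_along_arc (geo_arc Bu) (mdist_ge0 _ _) h).
move=> t t0 tL; have tI : 0 <= t <= mdist x u by rewrite t0.
have Bt := geo_ball Bu tI; have dt := geo_dist Bu tI.
rewrite !alongE// ?lexx ?mdist_ge0// geo0// fE// oseg_geo// dt.
have gt_arc : unit_arc (geo x (geo x u t)) t by rewrite -[X in unit_arc _ X]dt; exact: geo_arc.
rewrite arc_integral//.
  apply: eq_integral => s; rewrite inE/= in_itv/= => /andP[s0 st].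
  by rewrite geo_initial// ltW.
have := gint x _ (ball_self x) Bt; rewrite oseg_geo// dt.
exact: measurable_int.
Qed.

Section lipschitz.
Context (f : X -> R) (K : R) (K0 : 0 <= K).
Context (fK : forall y z, `|f y - f z| <= K * mdist y z).

Lemma along_lipschitz x u : B x u -> forall s t, `|along f x u s - along f x u t| <= K * `|s - t|.
Proof.
move=> Bu s t; apply: le_trans (fK _ _) _; rewrite ler_wpM2l//.
exact: arc_clamp_nonexpansive (geo_arc Bu) (mdist_ge0 _ _).
Qed.

Definition quotient x n z : R :=
  n.+1%:R * (f z - f (geo x z (clamp (mdist x z) (mdist x z - n.+1%:R^-1)))).

(** The upper limit of the difference quotients towards [x] is a formula valid on
    all the geodesics from [x] at once, which makes the pieces of the gradient
    match; the truncation at height [K] gives integrability and changes nothing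
    where the derivative exists. *)
Definition grad x z : R := Num.max (- K) (Num.min K
  (fine (limn_esup (fun n => (quotient x n z)%:E)))).

Definition along_grad x u (t : R) : R := Num.max (- K) (Num.min K
  (fine (limn_esup (fun n =>
     (n.+1%:R * (along f x u t - along f x u (t - n.+1%:R^-1)))%:E)))).

Lemma grad_along x u t : B x u -> t \in `]0, mdist x u[ ->
  grad x (geo x u t) = along_grad x u t.
Proof.
move=> Bu tL; have tI := itv_oo_cc tL; have [t0 tu] := andP tI.
rewrite /grad /along_grad; congr (Num.max _ (Num.min _ (fine (limn_esup _)))).
apply/funext => n; rewrite /quotient geo_dist// alongE//; congr (_ * (_ - f _))%:E.
have k0 : 0 < n.+1%:R^-1 :> R by rewrite invr_gt0.
have /andP[c0 ct] := clamp_itv (t - n.+1%:R^-1) t0.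
rewrite geo_initial//; congr (geo x u _).
move: k0; rewrite /clamp; move: _^-1 => k k0.
rewrite min_l; last by lra.
by rewrite min_l//; lra.
Qed.

Lemma along_continuous x u : B x u -> continuous (along f x u).
Proof. by move=> Bu; exact: (lipschitz_continuous (along_lipschitz Bu)). Qed.

Lemma measurable_along_grad x u : B x u ->
  measurable_fun setT (along_grad x u).
Proof.
move=> Bu; rewrite /along_grad.
apply: measurable_maxr; first exact: measurable_cst.
apply: measurable_minr; first exact: measurable_cst.
apply: measurableT_comp => //; apply: measurable_fun_limn_esup => n.
apply/measurable_EFinP; apply: measurable_funM; first exact: measurable_cst.
have mF : measurable_fun setT (along f x u).
  by apply: continuous_measurable_fun; exact: along_continuous.
apply: measurable_funB => //; apply: (measurableT_comp mF).
exact: measurable_funB.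
Qed.

Lemma grad_bound x z : `|grad x z| <= K.
Proof.
rewrite ler_norml /grad le_max lexx/= ge_max ge_min lexx/= andbT.
by have := K0; lra.
Qed.

Lemma along_grad_slope x u t l : B x u ->
  has_slope (along f x u) t l -> along_grad x u t = l.
Proof.
move=> Bu fl.
have := has_slope_bound (along_lipschitz Bu) fl; rewrite ler_norml => /andP[l1 l2].
rewrite /along_grad.
set q := fun n : nat => _.
have ql : q @ \oo --> l%:E.
  by apply/fine_cvgP; split; [exact: nearW|exact: has_slope_left_cvg fl].
rewrite is_cvg_limn_esupE; last by apply/cvg_ex; exists l%:E.
by rewrite (cvg_lim _ ql)//= min_r// max_r.
Qed.

Lemma along_grad_primitive x u : B x u ->
  {ae leb, forall t, t \in `]0, mdist x u[ -> has_slope (along f x u) t (along_grad x u t)} /\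
  (f u - f x)%:E = (\int[leb]_(t in `]0%R, mdist x u[) (along_grad x u t)%:E)%E.
Proof.
move=> Bu; have [G intG GE] := lipschitz_primitive (mdist x u) (along_lipschitz Bu).
have slopeG := primitive_has_slope intG GE.
split.
  apply: filterS slopeG; first exact: (ae_filter_ringOfSetsType leb).
  by move=> t h tL; rewrite (along_grad_slope Bu (h tL)); exact: h.
have := GE (mdist x u) (mdist_ge0 _ _) (lexx _).
rewrite !alongE ?lexx ?mdist_ge0// geo0// geo1// => ->.
apply: ae_eq_integral => //.
- exact: measurable_int intG.
- apply/measurable_EFinP; apply: measurable_funTS; exact: measurable_along_grad.
- apply: filterS slopeG; first exact: (ae_filter_ringOfSetsType leb).
  by move=> t h tL; rewrite (along_grad_slope Bu (h tL)).
Qed.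

Lemma measurable_grad x : @measurable_fun _ _ segT _ (S `&` B x) (grad x).
Proof.
apply: measurable_fun_skeleton_ball => u Bu; rewrite oseg_geo//.
apply: (measurable_from_arc (geo_arc Bu)).
apply: (eq_measurable_fun (along_grad x u)).
  by move=> t; rewrite inE => tL; rewrite /= grad_along.
by apply: measurable_funTS; exact: measurable_along_grad.
Qed.

(** The candidate is almost everywhere the density provided by
    [lipschitz_primitive] along each geodesic. *)
Lemma lipschitz_weak_gradient x : weak_gradient nu x f (grad x).
Proof.
have subm u v : B x u -> B x v ->
    @measurable_fun _ _ segT _ (oseg (B x) u v) (grad x).
  move=> Bu Bv; have [sub _ _] := oseg_in_chart Bu Bv.
  exact: (measurable_funS (measurable_skeleton_ball x) sub (@measurable_grad x)).
split; first exact: (@measurable_grad x).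
- move=> u v Bu Bv; have [sub mo no] := oseg_in_chart Bu Bv.
  apply: measurable_bounded_integrable => //.
  + by rewrite [ltLHS]no ltry.
  + exact: subm.
  + exists K; split; first exact: num_real.
    by move=> k Kk z _; rewrite /= (le_trans (grad_bound x z))// ltW.
- move=> u Bu; rewrite (along_grad_primitive Bu).2.
  have := subm _ _ (ball_self x) Bu; rewrite (oseg_geo Bu) => /measurable_EFinP mg.
  rewrite (arc_integral (geo_arc Bu) (mdist_ge0 _ _) mg).
  by apply: eq_integral => t; rewrite inE => tL /=; rewrite grad_along.
Qed.

Lemma grad_slope x u : B x u -> {ae leb, forall t, t \in `]0, mdist x u[ ->
  has_slope (along f x u) t (grad x (geo x u t))}.
Proof. exact: weak_gradient_slope (lipschitz_weak_gradient x). Qed.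

(** Consider the parameters at which a geodesic of one chart meets a geodesic of
    another one. Apart from isolated ones, which are countably many, each of them
    is a limit of such parameters, along which the two difference quotients agree
    up to a sign. *)
Lemma negligible_grad_spokes x u y v : B x u -> B y v ->
  nu.-negligible (oseg (B x) x u `&` oseg (B y) y v `&`
                  [set z | `|grad x z| != `|grad y z|]).
Proof.
move=> Bu Bv.
have phiL := geo_arc Bu; have psiL := geo_arc Bv.
pose E := [set t | (t \in `]0, mdist x u[) /\ oseg (B y) y v ((geo x u) t)].
have N0 : leb.-negligible (isolated E).
  have cE := @countable_isolated _ E.
  have mE : measurable (isolated E) by exact: countable_measurable.
  by apply/negligibleP => //; exact: countable_lebesgue_measure0.
have N1 := negligible_arc phiL (grad_slope Bu).
have N2 := negligible_arc psiL (grad_slope Bv).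
apply: negligibleS (negligibleU (negligibleU (negligible_arc phiL N0) N1) N2).
move=> z [[xz yz] zne]; have := xz; rewrite oseg_geo// => -[t tL tz].
have := yz; rewrite oseg_geo// => -[s sL sz].
have Et : E t by split => //; rewrite tz.
have [iE|niE] := pselect (isolated E t); first by left; left; exists t.
have [s1|ns1] := pselect (has_slope (along f x u) t (grad x ((geo x u) t))); last first.
  by left; right; exists t => //; split => // h; apply: ns1; exact: h.
have [s2|ns2] := pselect (has_slope (along f y v) s (grad y ((geo y v) s))); last first.
  by right; exists s => //; split => // h; apply: ns2; exact: h.
suff h : `|grad x ((geo x u) t)| = `|grad y ((geo y v) s)|.
  by move: zne; rewrite /= -{1}tz -sz h eqxx.
apply: (has_slope_norm_eq s1 s2) => d d0.
have [t' [Et' tt']] : exists t', E t' /\ 0 < `|t' - t| < d.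
  apply: contrapT => /forallNP H; apply: niE; split; first by rewrite inE.
  exists (ball t d); first exact: nbhsx_ballx.
  apply/seteqP; split => [r [rd Er]|_ ->]; last by split => //; exact: ballxx.
  apply: contrapT => /= rt; apply: (H r); split => //.
  by rewrite normr_gt0 subr_eq0; move/eqP : rt => -> /=; rewrite distrC.
have [t'L] := Et'; rewrite oseg_geo// => -[s' s'L s't'].
have /andP[tt0 ttd] := tt'.
have sE : `|s' - s| = `|t' - t|.
  rewrite -(phiL t' t) ?itv_oo_cc//  tz  -s't' -sz.
  by rewrite psiL ?itv_oo_cc.
by exists t', s'; rewrite !alongE ?itv_oo_cc//   tz sz s't'.
Qed.

(** Up to the two centres, countably many pairs of segments cover the overlap of
    the charts. *)
Lemma negligible_grad x y :
  nu.-negligible (S `&` B x `&` B y `&` [set z | `|grad x z| != `|grad y z|]).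
Proof.
pose Q := [set z | `|grad x z| != `|grad y z|].
have N1 : nu.-negligible (S `&` [set x]).
  have [->|[_ -> mx nx]] := skeleton_center x; first exact: negligible_set0.
  by exists [set x]; split.
have N2 : nu.-negligible (S `&` [set y]).
  have [->|[_ -> mx nx]] := skeleton_center y; first exact: negligible_set0.
  by exists [set y]; split.
have N3 : nu.-negligible (\bigcup_m \bigcup_n
    (oseg (B x) x (e m) `&` oseg (B y) y (e n) `&` Q)).
  apply: negligible_bigcup => m; apply: negligible_bigcup => n.
  have [Bm|nBm] := pselect (B x (e m)); last first.
    by rewrite oseg_outside// !set0I; exact: negligible_set0.
  have [Bn|nBn] := pselect (B y (e n)); last first.
    by rewrite (oseg_outside nBn) setI0 set0I; exact: negligible_set0.
  exact: negligible_grad_spokes.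
apply: negligibleS (negligibleU (negligibleU N1 N2) N3) => z [[[Sz Bx] By] Qz].
have [zx|/eqP zx] := eqVneq z x; first by left; left.
have [zy|/eqP zy] := eqVneq z y; first by left; right.
have [m _ zm] := skeleton_spoke Sz Bx zx; have [n _ zn] := skeleton_spoke Sz By zy.
by right; exists m => //; exists n.
Qed.

End lipschitz.

(** * Energy of Lipschitz functions *)
Section modulus.
Context (f : X -> R) (K : R) (K0 : 0 <= K).
Context (fK : forall y z, `|f y - f z| <= K * mdist y z).

Lemma chart_exists z : exists n, B (e n) z.
Proof.
have [n zn] := e_dense z rlow0; exists n.
by apply/ball_mdist; rewrite metric_sym (lt_le_trans zn).
Qed.

Lemma chart_boolP z : exists n, `[< B (e n) z >].
Proof. by have [n zn] := chart_exists z; exists n; apply/asboolP. Qed.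

Definition chart z : nat := ex_minn (chart_boolP z).

(** The gradients of countably many charts are patched along a measurable
    partition; by [negligible_grad] the patches match in every chart. *)
Definition modulus (z : segT) : R := `|grad f K (e (chart z)) z|.

Lemma chartP z : B (e (chart z)) z.
Proof. by rewrite /chart; case: ex_minnP => n /asboolP. Qed.

Lemma chart_min z n : B (e n) z -> (chart z <= n)%N.
Proof. by move=> /asboolP zn; rewrite /chart; case: ex_minnP => k _; exact. Qed.

Lemma measurable_modulus : measurable_fun (S : set segT) modulus.
Proof.
pose F n : set segT := S `&` B (e n).
have mF n : measurable (F n) by exact: measurable_skeleton_ball.
have -> : S = \bigcup_n seqDU F n.
  by rewrite -seqDU_bigcup_eq; exact: skeletonE.
have mD n : measurable (seqDU F n).
  by apply: measurableD => //; exact: bigsetU_measurable.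
apply/measurable_fun_bigcup => // n.
apply: (@eq_measurable_fun _ _ segT R _ (fun z => `|grad f K (e n) z|)).
  move=> z; rewrite inE => -[[Sz Bz] nz]; rewrite /modulus.
  suff -> : chart z = n by [].
  apply/eqP; rewrite eqn_leq chart_min//= leqNgt; apply/negP => zn.
  by apply: nz; rewrite -bigcup_mkord; exists (chart z) => //; split => //; exact: chartP.
apply: measurableT_comp => //.
apply: (measurable_funS (mF n)); first exact: subDsetl.
exact: (measurable_grad K0 fK (x := e n)).
Qed.

Lemma lipschitz_abs_gradient : abs_gradient nu f modulus.
Proof.
split; first exact: measurable_modulus.
move=> x; exists (grad f K x); first exact: lipschitz_weak_gradient.
have N : nu.-negligible (\bigcup_n (S `&` B (e n) `&` B x `&`
    [set z | `|grad f K (e n) z| != `|grad f K x z|])).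
  by apply: negligible_bigcup => n; exact: negligible_grad.
apply: negligibleS N => z /= /not_implyP[[Sz Bz] /eqP zne].
by exists (chart z) => //; split => //; split => //; split => //; exact: chartP.
Qed.

(** Any version of the gradient is almost everywhere a derivative along a
    geodesic: it is at most the Lipschitz constant, and zero where the function is
    locally constant. *)
Lemma abs_gradient_bound (T : set X) h :
  (forall z, S z -> ~ T z ->
    exists2 r, 0 < r & forall z', mdist z z' < r -> f z' = f z) ->
  abs_gradient nu f h ->
  {ae nu, forall z, S z -> `|h z| <= K * \1_T z}.
Proof.
move=> fT [mh hx].
have N : nu.-negligible (S `&` [set z | ~ (`|h z| <= K * \1_T z)]).
  apply: negligible_skeleton => x.
  have [g wg hg] := hx x.
  have N1 : nu.-negligible (S `&` B x `&` [set z | ~ (`|g z| <= K * \1_T z)]).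
    apply: negligible_skeleton_ball => u Bu.
    apply: negligibleS (weak_gradient_slope wg Bu) => t [tL /= nb] slope.
    apply: nb; have {}slope := slope tL; have tI := itv_oo_cc tL.
    have gK := has_slope_bound (along_lipschitz K0 fK Bu) slope.
    have [Tz|nTz] := pselect (T (geo x u t)).
      by rewrite indicE mem_set// mulr1.
    have Sz : S (geo x u t).
      have [sub _ _] := oseg_in_chart (ball_self x) Bu.
      have [] // := sub (geo x u t); rewrite oseg_geo//; by exists t.
    have [r r0 fr] := fT _ Sz nTz.
    rewrite (has_slope_locally_constant slope) ?normr0; last first.
      exists r => // s st; rewrite (alongE _ tI); apply: fr.
      have := arc_clamp_nonexpansive t s (geo_arc Bu) (mdist_ge0 _ _).
      by rewrite clamp_id// => /le_lt_trans; apply; rewrite distrC.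
    by rewrite mulr_ge0// indicE; case: (_ \in _).
  apply: negligibleS (negligibleU N1 hg) => z [[Sz Bz] nb].
  have [hgz|nhgz] := eqVneq (h z) `|g z|.
    by left; split => // b; apply: nb; rewrite hgz normr_id.
  by right => /(_ (conj Sz Bz)) hgz; move: nhgz; rewrite hgz eqxx.
by apply: negligibleS N => z /= /not_implyP[Sz nb]; split.
Qed.

Lemma energy_bound (p l : R) (T : set segT) h : 1 <= p -> measurable T ->
  (nu T <= l%:E)%E ->
  (forall z, S z -> ~ T z ->
    exists2 r, 0 < r & forall z', mdist z z' < r -> f z' = f z) ->
  abs_gradient nu f h -> (energy nu p h <= (K `^ p * l)%:E)%E.
Proof.
move=> p1 mT Tl fT hf; have [mh _] := hf.
have p0 : 0 <= p by rewrite (le_trans _ p1).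
have pn0 : p != 0 by rewrite gt_eqF// (lt_le_trans _ p1).
have mS : measurableX S := measurable_skeleton.
have Kp : 0 <= K `^ p by exact: powR_ge0.
rewrite /energy.
apply: (@le_trans _ _ (\int[nu]_(z in S) (K `^ p * \1_T z)%:E)%E).
  apply: ae_ge0_le_integral => //.
  - apply/measurable_EFinP; apply: (measurableT_comp (measurable_powR p)).
    exact: measurableT_comp.
  - by move=> z _; rewrite lee_fin mulr_ge0// indicE; case: (_ \in _).
  - apply/measurable_EFinP; apply: measurable_funM; first exact: measurable_cst.
    exact: measurable_indic.
  - apply: filterS (abs_gradient_bound fT hf); first exact: (ae_filter_ringOfSetsType nu).
    move=> z hz Sz; rewrite lee_fin; have := hz Sz; rewrite indicE.
    case: (z \in T); rewrite ?mulr1 ?mulr0 => b.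
      by rewrite ge0_ler_powR ?nnegrE.
    have -> : `|h z| = 0 by apply/eqP; rewrite eq_le b normr_ge0.
    by rewrite powR0.
under eq_integral do rewrite EFinM.
rewrite ge0_integralZl//; last by apply/measurable_EFinP; exact: measurable_indic.
rewrite integral_indic// EFinM lee_wpmul2l//.
apply: (le_trans _ Tl); apply: le_measure; rewrite ?inE//.
exact: measurableI.
Qed.

End modulus.

End length.

(** * Separated nets and the packing bound *)
Section net.
Context {R : realType} {X : pmetricType R}.
Implicit Types (x y z : X) (r s t : R).

Lemma open_ball_mdist x r : open (ball x r).
Proof.
rewrite openE => y /ball_mdist xy; apply/nbhs_ballP.
exists (r - mdist x y); first by rewrite /= subr_gt0.
move=> z /ball_mdist yz; apply/ball_mdist.
by apply: le_lt_trans (metric_triangle _ y _) _; rewrite -ltrBrDl.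
Qed.

Lemma dense_sequence : separable X ->
  exists e : nat -> X, forall x r, 0 < r -> exists n, mdist x (e n) < r.
Proof.
move=> [D cD dD].
have D0 : D !=set0.
  by have [z [_ Dz]] := dD setT (ex_intro _ point I) openT; exists z.
have /pfcard_geP[D0'|[e]] := cD; first by move: D0; rewrite D0' => -[].
exists e => x r r0.
have [z [xz Dz]] := dD (ball x r) (ex_intro _ x (ballxx x r0)) (open_ball_mdist x r).
have [n _ nz] : (e @` setT) z by apply: (@surj _ _ _ _ e).
by exists n; rewrite nz; exact/ball_mdist.
Qed.

Context (e : nat -> X) (r : R) (r0 : 0 < r).

(** Greedy selection: an index is kept when its point is at distance at least [r]
    from the points kept before it. *)
Fixpoint greedy n : seq nat :=
  if n is n'.+1 then
    if all (fun k => r <= mdist (e n') (e k)) (greedy n')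
    then n' :: greedy n' else greedy n'
  else [::].

Definition net : set nat := [set n | n \in greedy n.+1].

Lemma mem_greedy n k : (k \in greedy n) = (k < n)%N && (k \in greedy k.+1).
Proof.
elim: n k => [//|n IH] k; rewrite ltnS leq_eqVlt.
have gn : n \notin greedy n by rewrite IH ltnn.
have [->|kn] /= := eqVneq k n; first by [].
rewrite -IH; case: ifP => // _.
by rewrite inE (negbTE kn).
Qed.

Lemma net_separated i j : net i -> net j -> i <> j -> r <= mdist (e i) (e j).
Proof.
wlog ij : i j / (i < j)%N => [H|ni nj _].
  move=> ni nj /eqP; rewrite neq_ltn => /orP[ij|ji].
    by apply: H => // /eqP; rewrite ltn_eqF.
  by rewrite metric_sym; apply: H => // /eqP; rewrite ltn_eqF.
have ig : i \in greedy j by rewrite mem_greedy ij.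
move: nj; rewrite /net /=; case: ifP => [/allP h _|_]; last first.
  by rewrite mem_greedy ltnn.
by rewrite metric_sym; exact: h.
Qed.

Lemma net_cover_dense n : exists2 k, net k & mdist (e n) (e k) < r.
Proof.
have [nn|] := boolP (n \in greedy n.+1); first by exists n => //; rewrite mdistxx.
rewrite /=; case: ifPn => [_|/allPn[k kn]]; first by rewrite inE eqxx.
rewrite -ltNge => nk _; exists k => //.
by move: kn; rewrite mem_greedy => /andP[].
Qed.

Lemma net_cover : (forall x s, 0 < s -> exists n, mdist x (e n) < s) ->
  forall x, exists2 k, net k & mdist x (e k) < r + r.
Proof.
move=> e_dense x; have [n xn] := e_dense x r r0; have [k nk kn] := net_cover_dense n.
by exists k => //; apply: le_lt_trans (metric_triangle _ (e n) _) _; exact: ltrD.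
Qed.

End net.

Section packing.
Context {R : realType} {X : pmetricType R}
  (m : {measure set (borelType X) -> \bar R}).
Implicit Types (x y z : X) (r s t : R).

Lemma measurable_ballX x r : 0 < r -> measurable (ball x r : set (borelType X)).
Proof. by move=> r0; apply: sub_sigma_algebra; exact: open_ball_mdist. Qed.

(** Volume control bounds the number of separated points in a ball: the
    small balls around them are disjoint and have comparable volume. *)
Lemma volume_packing (k : R) : 1 <= k -> uniform_volume_control m ->
  exists (r1 : R) (N : nat), 0 < r1 /\ forall r, 0 < r -> r < r1 ->
    (forall z, m (ball z (k * r)) < +oo)%E /\
    forall (c : nat -> X) (F : {fset nat}) z,
      (forall i j, i \in F -> j \in F -> i <> j -> r / 2 <= mdist (c i) (c j)) ->
      (forall i, i \in F -> mdist (c i) z < k * r) ->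
      (#|` F| <= N)%N.
Proof.
move=> k1 [r0 [Phi [a [c0 [C [[r00 a1 c00 C0] [Phi0 _] growth vol]]]]]].
have k0 : 0 < k by lra.
(* the large ball contains the small ones of radius r / 4, and q is the ratio of
   the radii *)
pose q := (k + 1) * 4.
pose M := C * (C * q `^ a) / c0.
exists (r0 / (k + 1)), (Num.bound M); split; first by rewrite divr_gt0//; lra.
move=> r rp; rewrite ltr_pdivlMr; last lra.
move=> rr0.
have kr : k * r < r0 by apply: le_lt_trans rr0; rewrite mulrDr mulr1 mulrC; lra.
have kr0 : 0 < k * r by rewrite mulr_gt0.
split.
  by move=> z; have /andP[_ h] := vol z _ kr0 kr; rewrite (le_lt_trans h)// ltry.
move=> c F z sepF Fz.
have r4 : 0 < r / 4 by rewrite divr_gt0.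
have r40 : r / 4 < r0.
  apply: lt_trans kr; have : r <= k * r by rewrite ler_peMl// ltW.
  by lra.
pose s := (k + 1) * r.
have s0 : 0 < s by rewrite mulr_gt0//; lra.
have sr0 : s < r0 by rewrite /s mulrC.
have r4s : r / 4 <= s.
  have : r <= k * r by rewrite ler_peMl// ltW.
  by rewrite /s mulrDl mul1r; lra.
have Phi4 : 0 < Phi (r / 4).
  rewrite lt_neqAle Phi0 ?in_itv/= ?ltW// andbT eq_sym; apply/eqP => P0.
  have /andP[h _] := growth (r / 4) (r / 4) r4 (lexx _) (ltW r40).
  by move: h; rewrite P0 mul0r divff ?gt_eqF// mulr1; lra.
have PhiS : Phi s <= C * q `^ a * Phi (r / 4).
  have /andP[_] := growth (r / 4) s r4 r4s (ltW sr0).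
  rewrite ler_pdivrMr//; suff -> : s / (r / 4) = q by [].
  by rewrite /s /q; field; rewrite gt_eqF.
have disj : trivIset [set` F] (fun i => ball (c i) (r / 4)).
  move=> i j iF jF [y [/ball_mdist iy /ball_mdist jy]].
  apply: contrapT => ij; have := sepF i j iF jF ij.
  have := metric_triangle (c i) y (c j); rewrite (metric_sym y).
  lra.
have := @measure_fin_bigcup _ R (borelType X) m _ [set` F]
  (fun i => ball (c i) (r / 4)) (finite_fset F) disj.
move=> /(_ (fun i _ => measurable_ballX (c i) r4)).
rewrite fsbig_finite//= set_fsetK => mE.
have mB : (m (\bigcup_(i in [set` F]) ball (c i) (r / 4)) <= (C * Phi s)%:E)%E.
  have /andP[_] := vol z s s0 sr0; apply: le_trans; apply: le_measure.
  - rewrite inE; apply: fin_bigcup_measurable => // i _; exact: measurable_ballX.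
  - by rewrite inE; exact: measurable_ballX.
  - move=> y [i iF /ball_mdist iy]; apply/ball_mdist.
    have := metric_triangle z (c i) y; have := Fz i iF.
    by rewrite (metric_sym z (c i)) /s mulrDl mul1r; lra.
have : ((#|` F|%:R * (c0 * Phi (r / 4)))%:E <= (C * Phi s)%:E)%E.
  apply: le_trans mB; rewrite mE.
  apply: (@le_trans _ _ (\sum_(i <- F) (c0 * Phi (r / 4))%:E)%E); last first.
    by apply: lee_sum => i _; have /andP[] := vol (c i) _ r4 r40.
  rewrite sumEFin lee_fin big_const_seq count_predT iter_addr addr0.
  by rewrite -[X in _ <= X]mulr_natl.
rewrite lee_fin => h.
have : #|` F|%:R <= M.
  rewrite /M ler_pdivlMr// -(ler_pM2r Phi4).
  apply: le_trans (_ : C * Phi s <= _); first by rewrite -mulrA.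
  by rewrite -!mulrA ler_pM2l// mulrA.
move=> FM; rewrite -(ler_nat R) (le_trans FM)// ltW// archi_boundP//.
by rewrite divr_ge0 ?(ltW c00)// !mulr_ge0 ?powR_ge0 ?(ltW C0).
Qed.

End packing.

(** * The tents and their increments *)
Section gromov_product.
Context {R : realType} {X : pmetricType R}.
Implicit Types (x y z : X).

Lemma gromov_lipschitz x z y y' : `|gromov x z y - gromov x z y'| <= mdist y y'.
Proof.
have h1 := metric_triangle x y y'; have h2 := metric_triangle x y' y.
have h3 := metric_triangle y y' z; have h4 := metric_triangle y' y z.
rewrite (metric_sym y' y) in h2 h4.
by rewrite /gromov ler_norml; apply/andP; split; lra.
Qed.

Lemma gromov_le x z y : gromov x z y <= mdist x y.
Proof. by have h := metric_triangle x y z; rewrite /gromov; lra. Qed.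

Lemma gromov_ge x z y : mdist x y - mdist y z <= gromov x z y.
Proof.
by have := metric_triangle x z y; rewrite /gromov (metric_sym z y); lra.
Qed.

End gromov_product.

Section bigmax.
Context {R : realType} {T : eqType}.
Implicit Types (s : seq T) (f g : T -> R).

Definition sup0 s f : R := \big[Num.max/0]_(i <- s) f i.

Lemma sup0_nil f : sup0 [::] f = 0.
Proof. exact: big_nil. Qed.

Lemma sup0_cons i s f : sup0 (i :: s) f = Num.max (f i) (sup0 s f).
Proof. exact: big_cons. Qed.

Lemma sup0_ge s f i : i \in s -> f i <= sup0 s f.
Proof.
elim: s => [//|j s IH]; rewrite inE sup0_cons le_max => /orP[/eqP->|/IH ->].
  by rewrite lexx.
by rewrite orbT.
Qed.

Lemma sup0_le s f c : 0 <= c -> (forall i, i \in s -> f i <= c) -> sup0 s f <= c.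
Proof.
move=> c0; elim: s => [_|j s IH H]; first by rewrite sup0_nil.
rewrite sup0_cons ge_max H ?mem_head//= IH// => i si.
by apply: H; rewrite inE si orbT.
Qed.

Lemma maxr_dist_le (a b c d k : R) : `|a - b| <= k -> `|c - d| <= k ->
  `|Num.max a c - Num.max b d| <= k.
Proof.
rewrite !ler_norml => /andP[? ?] /andP[? ?].
by case: (leP a c) => ?; case: (leP b d) => ?; apply/andP; split; lra.
Qed.

Lemma sup0_dist_le s f g k : 0 <= k -> (forall i, i \in s -> `|f i - g i| <= k) ->
  `|sup0 s f - sup0 s g| <= k.
Proof.
move=> k0; elim: s => [_|j s IH H]; first by rewrite !sup0_nil subrr normr0.
rewrite !sup0_cons; apply: maxr_dist_le; first by apply: H; rewrite mem_head.
by apply: IH => i si; apply: H; rewrite inE si orbT.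
Qed.

Lemma eq_sup0 s f g : {in s, f =1 g} -> sup0 s f = sup0 s g.
Proof. by move=> fg; apply: eq_big_seq. Qed.

End bigmax.

Section tents.
Context {R : realType} {X : pmetricType R} (rad : X -> R).
Implicit Types (x y z : X).
Local Notation B x := (ball x (rad x)).
Context (treeB : forall x, tree (B x)).
Context (eps : R) (eps0 : 0 < eps) (radE : forall x, 5 * eps <= rad x).
Context (c : nat -> X) (I : set nat).
Context (c_cover : forall x, exists2 k, I k & mdist x (c k) < eps).

Definition nearby (t : R) j : set nat := [set k | I k /\ mdist (c k) (c j) < t * eps].

Context (nearby_finite : forall j, finite_set (nearby 5 j)).

Definition neighbours j : seq nat := fset_set (nearby 5 j).

Lemma neighboursP j k : k \in neighbours j <-> nearby 5 j k.
Proof. by rewrite /neighbours in_fset_set// inE. Qed.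

(** The distance from [c j] to the projection of [y] on the finite subtree
    spanned by the neighbours of [c j], written with Gromov products. *)
Definition depth j y : R := sup0 (neighbours j) (fun k => gromov (c j) (c k) y).

(** The test on the distance only localizes the formula to the chart: the second
    branch extends by 0 a function that vanishes from distance [3 eps] on. *)
Definition tent j y : R :=
  if mdist (c j) y < 4 * eps then clamp 1 (2 - depth j y / eps) else 0.

Lemma depth_lipschitz j y y' : `|depth j y - depth j y'| <= mdist y y'.
Proof. by apply: sup0_dist_le => // [|k _]; [exact: mdist_ge0|exact: gromov_lipschitz]. Qed.

Lemma depth_le j y : depth j y <= mdist (c j) y.
Proof. by apply: sup0_le => [|k _]; [exact: mdist_ge0|exact: gromov_le]. Qed.

(** Some net point lies within [eps] of [y], and it is a neighbour of [c j]. *)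
Lemma depth_gt j y : mdist (c j) y < 4 * eps -> mdist (c j) y - eps < depth j y.
Proof.
move=> jy; have [k Ik yk] := c_cover y.
have kj : k \in neighbours j.
  apply/neighboursP; split => //; have := metric_triangle (c k) y (c j).
  by rewrite (metric_sym (c k) y) (metric_sym y (c j)); lra.
have := sup0_ge (fun k => gromov (c j) (c k) y) kj.
by have := gromov_ge (c j) (c k) y; rewrite -/(depth j y); lra.
Qed.

Lemma tent_itv j y : 0 <= tent j y <= 1.
Proof. by rewrite /tent; case: ifP => _; [exact: clamp_itv|rewrite lexx ler01]. Qed.

Lemma tent_near j y : mdist (c j) y < eps -> tent j y = 1.
Proof.
have e0 := eps0; move=> jy; have jy4 : mdist (c j) y < 4 * eps by lra.
rewrite /tent jy4.
have h : depth j y / eps < 1.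
  by rewrite ltr_pdivrMr// mul1r (le_lt_trans (depth_le j y)).
rewrite /clamp; move: (depth j y / eps) h => q h.
by rewrite min_r ?max_r//; lra.
Qed.

Lemma tent_far j y : 3 * eps <= mdist (c j) y -> tent j y = 0.
Proof.
move=> jy; rewrite /tent; case: ifP => // /depth_gt h.
have h' : 2 < depth j y / eps by rewrite ltr_pdivlMr//; lra.
rewrite /clamp; move: (depth j y / eps) h' => q h'.
by rewrite min_l ?max_l//; lra.
Qed.

Lemma tent_lipschitz j y y' : `|tent j y - tent j y'| <= eps^-1 * mdist y y'.
Proof.
have sym z z' : `|tent j z - tent j z'| <= eps^-1 * mdist z z' ->
    `|tent j z' - tent j z| <= eps^-1 * mdist z' z.
  by rewrite distrC metric_sym.
have far z z' : 4 * eps <= mdist (c j) z' -> `|tent j z - tent j z'| <= eps^-1 * mdist z z'.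
  move=> jz'; rewrite (tent_far (y := z')); last by have := eps0; lra.
  rewrite subr0; have [jz|jz] := leP (3 * eps) (mdist (c j) z).
    by rewrite tent_far// normr0 mulr_ge0 ?mdist_ge0// invr_ge0 ltW.
  have /andP[b0 b1] := tent_itv j z; rewrite ger0_norm// (le_trans b1)//.
  rewrite ler_pdivlMl// mulr1.
  by have := metric_triangle (c j) z z'; lra.
have [jy|jy] := leP (4 * eps) (mdist (c j) y); first by apply: sym; exact: far.
have [jy'|jy'] := leP (4 * eps) (mdist (c j) y'); first exact: far.
rewrite /tent jy jy'; apply: le_trans (clamp_nonexpansive _ _ _) _.
have -> : 2 - depth j y / eps - (2 - depth j y' / eps) =
  - (eps^-1 * (depth j y - depth j y')) by ring.
rewrite normrN normrM ger0_norm ?invr_ge0 ?(ltW eps0)//.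
by rewrite ler_pM2l ?invr_gt0// depth_lipschitz.
Qed.

(** Near [z], either the tent vanishes or all its finitely many Gromov products
    are constant. *)
Lemma tent_locally_constant j z :
  (mdist (c j) z < 4 * eps -> forall k, k \in neighbours j -> ~ between (c j) (c k) z) ->
  exists2 r, 0 < r & forall z', mdist z z' < r -> tent j z' = tent j z.
Proof.
move=> H; have [jz|jz] := leP (4 * eps) (mdist (c j) z).
  exists eps => // z' zz'; have h := metric_triangle (c j) z' z.
  rewrite (metric_sym z' z) in h.
  by rewrite !tent_far//; have := eps0; lra.
have {}H := H jz.
have jr x : mdist (c j) x < 5 * eps -> B (c j) x.
  by move=> h; apply/ball_mdist; exact: lt_le_trans h (radE _).
have Bz : B (c j) z by apply: jr; have := eps0; lra.
have Bj : B (c j) (c j) by apply: jr; rewrite mdistxx; have := eps0; lra.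
have {}jr x : mdist z x < eps -> B (c j) x.
  by move=> h; apply: jr; have := metric_triangle (c j) z x; lra.
have [r r0 rP] : exists2 r, 0 < r & forall z', mdist z z' < r -> B (c j) z' ->
    {in neighbours j, forall k, gromov (c j) (c k) z' = gromov (c j) (c k) z}.
  have Bk k : k \in neighbours j -> B (c j) (c k).
    move=> /neighboursP[_ kj]; apply/ball_mdist; rewrite metric_sym.
    exact: lt_le_trans kj (radE _).
  elim: (neighbours j) H Bk => [_ _|k s IH H Bk]; first by exists 1.
  have [||r r0 rP] := IH; [by move=> i si; apply: H; rewrite inE si orbT|
    by move=> i si; apply: Bk; rewrite inE si orbT|].
  have [r' r'0 r'P] := gromov_locally_constant (treeB (c j)) Bj
    (Bk k (mem_head _ _)) Bz (H k (mem_head _ _)).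
  exists (Num.min r r'); first by rewrite lt_min r0.
  move=> z'; rewrite lt_min => /andP[zr zr'] Bz' i; rewrite inE => /orP[/eqP->|si].
    exact: r'P.
  exact: rP.
pose q := Num.min (Num.min r eps) (4 * eps - mdist (c j) z).
exists q; first by rewrite !lt_min r0 eps0 subr_gt0.
move=> z'; rewrite !lt_min => /andP[/andP[zr ze] zj].
have jz' : mdist (c j) z' < 4 * eps by have := metric_triangle (c j) z z'; lra.
rewrite /tent jz jz' /depth; congr (clamp _ (_ - _ / _)).
by apply: eq_sup0 => k kj; apply: rP => //; exact: jr.
Qed.

(** The maximum of the first [n] tents. Its increments are a partition of unity
    that needs no division by the sum of the tents, so that the Lipschitz constant
    of the increments does not depend on the overlap. *)
Fixpoint crest n y : R :=
  if n is n'.+1 then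
    if `[< I n' >] then Num.max (crest n' y) (tent n' y) else crest n' y
  else 0.

Definition piece i y : R := crest i.+1 y - crest i y.

Lemma crest_itv n y : 0 <= crest n y <= 1.
Proof.
elim: n => [|n IH] /=; first by rewrite lexx ler01.
have /andP[b0 b1] := tent_itv n y; have /andP[c0 c1] := IH.
by case: asboolP => // _; rewrite le_max c0 ge_max c1.
Qed.

Lemma piece_out i y : ~ I i -> piece i y = 0.
Proof. by move=> nIi; rewrite /piece /= asboolF// subrr. Qed.

Lemma piece_itv i y : 0 <= piece i y <= tent i y.
Proof.
have /andP[b0 b1] := tent_itv i y; have /andP[c0 c1] := crest_itv i y.
rewrite /piece /=; case: asboolP => _; last by rewrite subrr lexx.
by case: (leP (crest i y) (tent i y)) => ?; apply/andP; split; lra.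
Qed.

Lemma piece_far i y : 3 * eps <= mdist (c i) y -> piece i y = 0.
Proof.
move=> /tent_far b0; have := piece_itv i y; rewrite b0.
by move=> h; apply/eqP; rewrite eq_le andbC.
Qed.

Lemma crest_lipschitz n y y' : `|crest n y - crest n y'| <= eps^-1 * mdist y y'.
Proof.
elim: n => [|n IH] /=.
  by rewrite subrr normr0 mulr_ge0 ?mdist_ge0// invr_ge0 ltW.
by case: ifP => _ //; apply: maxr_dist_le => //; exact: tent_lipschitz.
Qed.

Lemma piece_lipschitz i y y' : `|piece i y - piece i y'| <= 2 / eps * mdist y y'.
Proof.
have h1 := crest_lipschitz i.+1 y y'; have h2 := crest_lipschitz i y y'.
have -> : piece i y - piece i y' =
   (crest i.+1 y - crest i.+1 y') - (crest i y - crest i y') by rewrite /piece; ring.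
rewrite -mulrA mulrDl mul1r (le_trans (ler_normB _ _))//.
by rewrite lerD.
Qed.

Lemma crest_reaches_1 y : exists k, forall n, (k < n)%N -> crest n y = 1.
Proof.
have [k Ik yk] := c_cover y; exists k; elim=> [//|n IH].
rewrite ltnS leq_eqVlt => /orP[/eqP <-|kn] /=.
  rewrite asboolT// tent_near 1?metric_sym// max_r//.
  by have /andP[] := crest_itv k y.
rewrite IH//; case: asboolP => // _; rewrite max_l//.
by have /andP[] := tent_itv n y.
Qed.

Lemma sum_piece n y : \sum_(0 <= i < n) piece i y = crest n y.
Proof. by rewrite telescope_sumr// subr0. Qed.

(** The subtree on which the depth of the [j]-th tent varies: the union of the
    segments from its centre to its neighbours. *)
Definition spine j : set X :=
  [set z | exists2 k, k \in neighbours j & between (c j) (c k) z].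

(** Only the tents that do not vanish near [z] matter, and their centres are
    within [8 eps] of the [i]-th one unless the [i]-th piece itself vanishes
    near [z]. *)
Lemma piece_locally_constant i z :
  (forall j, I j -> mdist (c j) (c i) < 8 * eps -> mdist (c j) z < 4 * eps -> ~ spine j z) ->
  exists2 r, 0 < r & forall z', mdist z z' < r -> piece i z' = piece i z.
Proof.
move=> H; have [iz|iz] := leP (4 * eps) (mdist (c i) z).
  exists eps => // z' zz'; have h := metric_triangle (c i) z' z.
  rewrite (metric_sym z' z) in h.
  by rewrite !piece_far//; have := eps0; lra.
have tents j : I j -> exists2 r, 0 < r & forall z', mdist z z' < r -> tent j z' = tent j z.
  move=> Ij; apply: tent_locally_constant => jz k kj jkz.
  apply: (H j Ij _ jz); last by exists k.
  by have := metric_triangle (c j) z (c i); rewrite (metric_sym z (c i)); lra.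
have crests n : exists2 r, 0 < r & forall z', mdist z z' < r -> crest n z' = crest n z.
  elim: n => [|n [r r0 rP]]; first by exists 1.
  have [In|nIn] := pselect (I n); last by exists r => //= z'; rewrite asboolF//; exact: rP.
  have [r' r'0 r'P] := tents n In; exists (Num.min r r'); first by rewrite lt_min r0.
  by move=> z'; rewrite lt_min /= => /andP[/rP -> /r'P ->].
have [r r0 rP] := crests i; have [r' r'0 r'P] := crests i.+1.
exists (Num.min r r'); first by rewrite lt_min r0.
by move=> z'; rewrite lt_min /piece => /andP[/rP -> /r'P ->].
Qed.

End tents.

(** * The partition of unity *)
Lemma measure_bigsetU_le d (T : measurableType d) (R : realType)
    (mu : {measure set T -> \bar R}) (J : eqType) (s : seq J) (F : J -> set T) (l : R) :
  (forall i, i \in s -> measurable (F i) /\ (mu (F i) <= l%:E)%E) ->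
  measurable (\big[setU/set0]_(i <- s) F i) /\
  (mu (\big[setU/set0]_(i <- s) F i) <= ((size s)%:R * l)%:E)%E.
Proof.
elim: s => [_|i s IH H]; first by rewrite big_nil measure0 mul0r.
have [mi li] := H i (mem_head _ _).
have [|ms ls] := IH; first by move=> j sj; apply: H; rewrite inE sj orbT.
rewrite big_cons; split; first exact: measurableU.
apply: le_trans (measureU2 _ mi ms) _.
by rewrite /= -natr1 mulrDl mul1r addrC EFinD leeD.
Qed.

Lemma lipschitz_metric_continuous (R : realType) (X : pmetricType R) (f : X -> R) (K : R) :
  (forall y z, `|f y - f z| <= K * mdist y z) -> continuous f.
Proof.
move=> fK x; apply/(@cvgrPdist_lt _ R^o) => e e0.
have K0 : 0 < `|K| + 1 by rewrite ltr_wpDl.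
apply/nbhs_ballP; exists ((`|K| + 1)^-1 * e) => /=; first by rewrite mulr_gt0// invr_gt0.
move=> y /ball_mdist xy; apply: le_lt_trans (fK x y) _.
apply: (@le_lt_trans _ _ ((`|K| + 1) * mdist x y)).
  by rewrite ler_wpM2r ?mdist_ge0// ler_wpDr// ler_norm.
by rewrite -ltr_pdivlMl.
Qed.

Lemma continuous_borel_measurable (R : realType) (X : pmetricType R) (f : X -> R) :
  continuous f -> @measurable_fun _ _ (borelType X) R setT f.
Proof.
move=> /continuousP cf.
apply: (@measurability _ _ (borelType X) R setT f _ (RGenOpens.measurableE R)).
move=> _ [_ [a [b ->]] <-]; rewrite setTI; apply: sub_sigma_algebra.
by apply: cf; exact: interval_open.
Qed.

Lemma bounded_support_Lfun (R : realType) (X : pmetricType R)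
    (m : {measure set (borelType X) -> \bar R}) (p : R) (f : borelType X -> R)
    (A : set (borelType X)) : 1 <= p -> measurable A -> (m A < +oo)%E ->
  measurable_fun setT f -> (forall z, 0 <= f z <= \1_A z) -> f \in Lfun m p%:E.
Proof.
move=> p1 mA Afin mf f01; apply/andP; split; rewrite inE//=.
have p0 : p != 0 by rewrite gt_eqF// (lt_le_trans _ p1).
rewrite /finite_norm unlock /= poweR_lty//.
apply: le_lt_trans Afin.
have -> : m A = (\int[m]_z (\1_A z)%:E)%E by rewrite integral_indic// setIT.
apply: ge0_le_integral => //.
- apply/measurable_EFinP; apply: (measurableT_comp (measurable_powR p)).
  exact: measurableT_comp.
- by apply/measurable_EFinP; exact: measurable_indic.
move=> z _; rewrite lee_fin.
have /andP[f0] := f01 z; rewrite indicE (ger0_norm f0).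
case: (z \in A) => f1.
  have := @ge0_ler_powR R p (le_trans ler01 p1) (f z) 1.
  by rewrite powR1; apply; rewrite ?nnegrE.
have -> : f z = 0 by apply/eqP; rewrite eq_le f0 f1.
by rewrite powR0.
Qed.

Section partition_of_unity.
Context (R : realType) (X : pmetricType R) (rad : X -> R) (V : set X)
  (nu : {measure set (segType rad V) -> \bar R})
  (m : {measure set (borelType X) -> \bar R}) (p : R) (p1 : 1 <= p).
Context (rlow : R) (rlow0 : 0 < rlow) (radE : forall x, rlow <= rad x)
  (treeB : forall x, tree (ball x (rad x))) (nulen : length_measure nu).
Context (e : nat -> X) (e_dense : forall x r, 0 < r -> exists n, mdist x (e n) < r).
Context (eps k : R) (eps0 : 0 < eps) (eps_rlow : 5 * eps <= rlow) (k8 : 8 <= k) (N : nat).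
Context (ball_finite : forall z, (m (ball z (k * eps)) < +oo)%E)
  (packing : forall (c : nat -> X) (F : {fset nat}) z,
    (forall i j, i \in F -> j \in F -> i <> j -> eps / 2 <= mdist (c i) (c j)) ->
    (forall i, i \in F -> mdist (c i) z < k * eps) -> (#|` F| <= N)%N).
Local Notation S := (skeleton rad).
Local Notation I := (net e (eps / 2)).

Lemma net_ball_card (J : set nat) z : J `<=` I ->
  (forall i, J i -> mdist (e i) z < k * eps) ->
  finite_set J /\ (#|` fset_set J| <= N)%N.
Proof.
move=> JI Jz.
have bound (F : {fset nat}) : [set` F] `<=` J -> (#|` F| <= N)%N.
  move=> FJ; apply: (@packing e F z).
    by move=> i j /FJ/JI Ii /FJ/JI Ij; exact: net_separated.
  by move=> i /FJ; exact: Jz.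
have Jfin : finite_set J.
  apply: contrapT => /(infinite_set_fset N.+1)[F FJ NF].
  by have := leq_trans NF (bound _ FJ); rewrite ltnn.
by split => //; apply: bound => i /=; rewrite in_fset_set// inE.
Qed.

Lemma nearby_card t j : t <= 8 ->
  finite_set (nearby eps e I t j) /\ (#|` fset_set (nearby eps e I t j)| <= N)%N.
Proof.
move=> t8; apply: (@net_ball_card _ (e j)) => [i []//|i [_ ij]].
by apply: lt_le_trans ij _; rewrite ler_pM2r//; have := k8; lra.
Qed.

Let fin5 j : finite_set (nearby eps e I 5 j).
Proof. by have [] := @nearby_card 5 j ltac:(lra). Qed.

Let cover x : exists2 i, I i & mdist x (e i) < eps.
Proof.
have e20 : 0 < eps / 2 by rewrite divr_gt0.
by have [i Ii xi] := net_cover e20 e_dense x; exists i => //; rewrite [ltRHS]splitr.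
Qed.

Let rad5 x : 5 * eps <= rad x. Proof. exact: le_trans eps_rlow (radE x). Qed.

Local Notation phi := (piece eps e I).

Let K : R := 2 / eps.
Let K0 : 0 <= K. Proof. by rewrite divr_ge0// ltW. Qed.
Let phiK i y z : `|phi i y - phi i z| <= K * mdist y z.
Proof. exact: piece_lipschitz. Qed.

(** At most [N] subtrees, each made of at most [N] segments of length at most
    [5 eps], carry a gradient of modulus at most [2 / eps]. *)
Lemma piece_energy i (h : segType rad V -> R) : abs_gradient nu (phi i) h ->
  (energy nu p h <= (5 * 2 `^ p * N%:R ^+ 2 / eps `^ (p - 1))%:E)%E.
Proof.
move=> hf.
pose Js := fset_set (nearby eps e I 8 i).
have [Jfin Jcard] := @nearby_card 8 i (lexx _).
pose T : set (segType rad V) := \big[setU/set0]_(j <- Js)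
  \big[setU/set0]_(l <- neighbours eps e I j) (S `&` [set z | between (e j) (e l) z]).
have l0 : 0 <= 5 * eps by rewrite mulr_ge0// ltW.
have spine_le j : measurable (\big[setU/set0]_(l <- neighbours eps e I j)
      (S `&` [set z | between (e j) (e l) z]) : set (segType rad V)) /\
    (nu (\big[setU/set0]_(l <- neighbours eps e I j)
      (S `&` [set z | between (e j) (e l) z])) <= (N%:R * (5 * eps))%:E)%E.
  have [|mT nT] := @measure_bigsetU_le _ (segType rad V) R nu _
      (neighbours eps e I j) (fun l => S `&` [set z | between (e j) (e l) z]) (5 * eps).
    move=> l /(neighboursP fin5)[Il lj].
    have Bl : ball (e j) (rad (e j)) (e l).
      by apply/ball_mdist; rewrite metric_sym (lt_le_trans lj).
    have [ms ns] := segment_trace rlow0 radE treeB nulen Bl.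
    by split => //; apply: le_trans ns _; rewrite lee_fin metric_sym ltW.
  split => //; apply: le_trans nT _; rewrite lee_fin ler_wpM2r// ler_nat.
  by have [] := @nearby_card 5 j ltac:(lra).
have [mT nT] := @measure_bigsetU_le _ (segType rad V) R nu _ Js _ _ (fun j _ => spine_le j).
have nT' : (nu T <= (N%:R * (N%:R * (5 * eps)))%:E)%E.
  apply: le_trans nT _; rewrite lee_fin ler_wpM2r ?ler_nat//.
  by rewrite mulr_ge0.
have := energy_bound rlow0 radE treeB nulen e_dense K0 (@phiK i) p1 mT nT' _ hf.
have -> : K `^ p * (N%:R * (N%:R * (5 * eps))) =
    5 * 2 `^ p * N%:R ^+ 2 / eps `^ (p - 1).
  have e1 : eps `^ p * eps^-1 `^ p = 1.
    by rewrite -powRM ?invr_ge0 ?ltW// divff ?gt_eqF// powR1.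
  have e2 : eps `^ p = eps `^ (p - 1) * eps.
    rewrite -{3}(powRr1 (ltW eps0)) -powRD ?subrK//.
    by apply/implyP => _; rewrite gt_eqF.
  have pe0 : 0 < eps `^ (p - 1) by exact: powR_gt0.
  rewrite /K powRM ?invr_ge0 ?(ltW eps0)//.
  apply: (mulIf (lt0r_neq0 pe0)); rewrite divfK ?gt_eqF//.
  rewrite -[RHS]mulr1 -[X in _ = _ * X]e1 e2; ring.
apply => z Sz nTz; apply: (piece_locally_constant treeB eps0 rad5 cover fin5).
move=> j Ij ji jz [l lj jlz]; apply: nTz.
rewrite /T -bigcup_seq; exists j; first by rewrite /= in_fset_set// inE.
by rewrite -bigcup_seq; exists l.
Qed.

Lemma piece_absolutely_continuous i : abs_continuous_Lp nu p (phi i).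
Proof.
split.
  split; first exact: lipschitz_metric_continuous (@phiK i).
  move=> x; eexists.
  exact: (lipschitz_weak_gradient rlow0 radE treeB nulen e_dense K0 (@phiK i)).
have h := lipschitz_abs_gradient rlow0 radE treeB nulen e_dense K0 (@phiK i).
by eexists; first exact: h; apply: le_lt_trans (piece_energy h) _; rewrite ltry.
Qed.

Lemma piece_sobolev i : I i -> sobolev nu m p (phi i).
Proof.
move=> Ii; split; last first.
  by exists (phi i); [exact: piece_absolutely_continuous|exact: aeW].
have ke0 : 0 < k * eps by rewrite mulr_gt0//; have := k8; lra.
apply: (@bounded_support_Lfun _ _ _ _ _ (ball (e i) (k * eps))) => //.
- exact: measurable_ballX.
- by apply: continuous_borel_measurable; exact: lipschitz_metric_continuous (@phiK i).
move=> z; have /andP[f0 fb] := piece_itv eps e I i z.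
have /andP[b0 b1] := tent_itv eps e I i z.
rewrite f0 indicE /=; case: (boolP (z \in _)) => [_|]; first exact: le_trans b1.
rewrite notin_setE => /ball_mdist/negP; rewrite -leNgt => iz.
rewrite (piece_far eps0 cover fin5)//; apply: le_trans iz.
by rewrite ler_pM2r//; have := k8; lra.
Qed.

Lemma piece_esum z : (\esum_(i in I) (phi i z)%:E = 1)%E.
Proof.
have phi0 i : 0 <= phi i z by have /andP[] := piece_itv eps e I i z.
have -> : (\esum_(i in I) (phi i z)%:E = \esum_(i in [set: nat]) (phi i z)%:E)%E.
  rewrite esum_mkcond; apply: eq_esum => i _; case: ifPn => // /negP nI.
  by rewrite piece_out// => Ii; apply: nI; rewrite inE.
rewrite -nneseries_esumT; last by move=> n; rewrite lee_fin.
have [n nP] := crest_reaches_1 eps0 cover z.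
apply/cvg_lim => //; apply: (@cvg_near_cst _ _ _ _ _ _).
exists n.+1 => // l /= nl; rewrite sumEFin sum_piece.
by rewrite nP.
Qed.

End partition_of_unity.

Theorem theorem3p5 (R : realType) (X : pmetricType R) (rad : X -> R)
    (V : set X) (nu : {measure set (segType rad V) -> \bar R})
    (m : {measure set (borelType X) -> \bar R}) (p lambda : R)
    (Xlc : locally_compact [set: X]) (Xconn : connected [set: X])
    (Xsep : separable X) (Xtree : uniform_local_tree rad)
    (VS : countable_dense_in (skeleton rad) V) (nulen : length_measure nu)
    (mradon : radon m) (mfull : full_support m)
    (mvol : uniform_volume_control m)
    (p1 : 1 <= p) (lambda4 : 4 <= lambda) :
  exists eps0 C : R, [/\ 0 < eps0, 0 < C &
    forall eps : R, 0 < eps -> eps < eps0 ->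
    exists (I : set nat) (c : nat -> X) (phi : nat -> X -> R),
    [/\ \bigcup_(i in I) ball (c i) eps = [set: X],
        forall z : X,
          let J := [set i | I i /\ ball (c i) (lambda * eps) z] in
          finite_set J /\ (#|` fset_set J|%fset)%:R <= C,
        forall i, I i ->
        [/\ (* (i) *)
            sobolev nu m p (phi i) /\ abs_continuous_Lp nu p (phi i),
            (* (ii) *)
            forall z, 0 <= phi i z <= 1,
            (* (iv) *)
            forall z, ~ ball (c i) (4 * eps) z -> phi i z = 0 &
            (* (v) *)
            forall h, abs_gradient nu (phi i) h ->
              (energy nu p h <= (C / eps `^ (p - 1))%:E)%E] &
        (* (iii) *)
        forall z, (\esum_(i in I) (phi i z)%:E = 1)%E]].
Proof.
have [local [rlow [rlow0 _ _ radE]]] := Xtree.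
have treeB x : tree (ball x (rad x)) by have [] := local x.
have [e e_dense] := dense_sequence Xsep.
(* 8 eps is the reach of the tents that interact with a given one, and 5 eps is
   the radius at which neighbours are taken, which must stay inside the charts *)
pose k := Num.max lambda 8.
have k8 : 8 <= k by rewrite le_max lexx orbT.
have lk : lambda <= k by rewrite le_max lexx.
have k1 : 1 <= k by lra.
have [r1 [N [r10 packing]]] := volume_packing k1 mvol.
pose E := 5 * 2 `^ p * N%:R ^+ 2.
have E0 : 0 <= E by rewrite !mulr_ge0 ?powR_ge0.
exists (Num.min r1 (rlow / 5)), (N%:R + E + 1); split.
- by rewrite lt_min r10 divr_gt0.
- by rewrite ltr_wpDl// addr_ge0.
move=> eps eps0; rewrite lt_min => /andP[/(packing _ eps0)[ball_fin pack] eps_r].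
have eps_rlow : 5 * eps <= rlow by lra.
have e20 : 0 < eps / 2 by rewrite divr_gt0.
pose I := net e (eps / 2).
have cover x : exists2 i, I i & mdist x (e i) < eps.
  by have [i Ii xi] := net_cover e20 e_dense x; exists i => //; rewrite [ltRHS]splitr.
have fin5 j : finite_set (nearby eps e I 5 j).
  by have [] := @nearby_card R X e eps k eps0 k8 N pack 5 j ltac:(lra).
exists I, e, (piece eps e I); split.
- rewrite -subTset => x _; have [i Ii xi] := cover x; exists i => //.
  by apply/ball_mdist; rewrite metric_sym.
- move=> z J.
  have JI : J `<=` I by move=> i [].
  have Jz i : J i -> mdist (e i) z < k * eps.
    by move=> [_ /ball_mdist iz]; apply: lt_le_trans iz _; rewrite ler_pM2r.
  have [Jfin Jcard] := net_ball_card pack JI Jz.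
  by split => //; rewrite -addrA (le_trans (_ : _ <= N%:R))// ?ler_nat// lerDl addr_ge0.
- move=> i Ii; split.
  + split.
      exact: (piece_sobolev p1 rlow0 radE treeB nulen e_dense eps0 eps_rlow k8 ball_fin pack).
    exact: (piece_absolutely_continuous p1 rlow0 radE treeB nulen e_dense eps0
              eps_rlow k8 pack).
  + move=> z; have /andP[-> fb] := piece_itv eps e I i z.
    by have /andP[_] := tent_itv eps e I i z; exact: le_trans.
  + move=> z /ball_mdist/negP; rewrite -leNgt => iz.
    by rewrite (piece_far eps0 cover fin5)//; apply: le_trans iz; lra.
  + move=> h hf.
    have := piece_energy p1 rlow0 radE treeB nulen e_dense eps0 eps_rlow k8 pack hf.
    move=> /le_trans; apply.
    rewrite lee_fin ler_wpM2r ?invr_ge0 ?powR_ge0// -/E addrAC lerDr.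
    by rewrite addr_ge0.
- exact: (piece_esum e_dense eps0).
Qed.
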